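(* Let $b=1$, $r=1$, $x_R=1/2$, and let $\mathcal X(t)$ be (undrifted) Brownian motion with Poissonian resetting at rate $r$ to the position $x_R$, starting from a random initial position $\eta\in(0,b)$ independent of the driving Brownian motion and of the resetting Poisson process. For $\lambda>0$ set $\alpha_\lambda=\sqrt{2(\lambda+r)}=\sqrt{2(\lambda+1)}$. For integers $k\ge0$ and $\theta>0$ let $J_k(\theta)=\int_0^1e^{-\theta x}x^k\,dx$ and $$\widehat g_k(\theta)=\frac{(2k+1)!}{(k!)^2}\sum_{i=0}^k(-1)^i\binom ki J_{k+i}(\theta).$$ Let $N\ge1$ and let $p_1,\dots,p_N\ge0$ satisfy $\sum_{k=1}^Np_k=1$. Suppose that the Laplace transform of the first-passage-time (FPT) density $f(t)$, $t>0$, has the form $$\widehat f(\lambda)=\sum_{k=1}^Np_k\,\widehat f_k(\lambda),\qquad\lambda>0,$$ where $$\widehat f_k(\lambda)=\frac{2\sinh(\alpha_\lambda/2)+\lambda\left(e^{\alpha_\lambda}-1\right)\widehat g_k(\alpha_\lambda)}{\lambda\sinh(\alpha_\lambda)+2\sinh(\alpha_\lambda/2)}.$$ Then there exists a solution $g$ to the inverse first-exit time problem for $\mathcal X(t)$ corresponding to the FPT density $f$, and it is given by $$g(x)=\sum_{k=1}^Np_k\,g_k(x),\qquad x\in(0,1),$$ where $g_k$ is the density with Laplace transform $\widehat g_k$, namely the Beta density on $(0,1)$ with parameters $\alpha=\beta=k+1$: $$g_k(x)=\frac{(2k+1)!}{(k!)^2}\,x^k(1-x)^k,\qquad x\in(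0,1).$$
   Context: Brownian motion with Poissonian resetting: let $W_t$ be a standard Brownian motion and let resetting events occur according to a homogeneous Poisson process of rate $r>0$ independent of $W$. Until the first resetting event $\mathcal X(t)=\eta+W_t$. At each resetting event $\mathcal X$ is set instantly to $x_R\in(0,b)$; after that it evolves again as a Brownian motion starting afresh from $x_R$, independently of the past, until the next resetting event, and so on. For $C^2$ functions $u$ the generator of $\mathcal X$ is $\mathcal L u(x)=\frac12u''(x)+r(u(x_R)-u(x))$. First-exit time: $\tau=\inf\{t>0:\mathcal X(t)\notin(0,b)\}$, where $\mathcal X(0)=\eta$ is random. Inverse first-exit time problem: given a probability density $f$ on $(0,+\infty)$ (called the FPT density) with distribution function $F$, $f=F'$, a solution corresponding to $f$ is a probability density $g$ on $(0,b)$ such that, when $\eta$ has density $g$, one has $P[\tau\le t]=F(t)$ for all $t>0$. Laplace transforms: $\widehat f(\lambda)=\int_0^\infty e^{-\lambda t}f(t)\,dt$ for $\lambda>0$, and the Laplace transform of a density $g$ on $(0,1)$ is $\int_0^1e^{-\theta x}g(x)\,dx$. *)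

(* Defs.v *)
From HB Require Import structures.
From mathcomp Require Import all_boot all_order all_algebra.
From mathcomp Require Import all_classical all_reals all_analysis.

Set Implicit Arguments.
Unset Strict Implicit.
Unset Printing Implicit Defensive.

Import Order.TTheory GRing.Theory Num.Theory.
Import numFieldNormedType.Exports.

Local Open Scope classical_set_scope.
Local Open Scope ring_scope.

Section Independence.
Context (d : measure_display) (T : measurableType d) (R : realType).
Variable P : probability T R.

Definition sigma_rv (X : T -> R) : set (set T) :=
  preimage_set_system setT X measurable.

Definition sigma_process (I : Type) (D : set I) (X : I -> T -> R) :
    set (set T) :=
  <<s \bigcup_(i in D) sigma_rv (X i) >>.

(* Mutual independence of a family of sigma-algebras: the product rule over
   every finite subfamily. *)
Definition mutually_independent (I : eqType) (F : I -> set (set T)) : Prop :=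
  forall (J : seq I) (E : I -> set T), uniq J ->
    (forall i, i \in J -> F i (E i)) ->
    P (\bigcap_(i in [set` J]) E i) = (\prod_(i <- J) P (E i))%E.

End Independence.

Section Processes.
Context (d : measure_display) (T : measurableType d) (R : realType).
Variable P : probability T R.

(* Time is a real number, but nothing is required at negative times.  The
   increments along every infinite nondecreasing sequence of times are
   independent; as independence only concerns finite subfamilies, this is the
   usual condition on finite sequences of times. *)
Record standard_brownian_motion (W : R -> {RV P >-> R}) : Prop := {
  bm_start : forall w, W 0 w = 0 ;
  bm_continuous :
    forall w, {within `[0, +oo[, continuous (fun t : R => W t w)} ;
  bm_normal : forall s t : R, 0 <= s -> s < t ->
    forall A : set R, measurable A ->
      P ((fun w => W t w - W s w) @^-1` A)
        = normal_prob 0 (Num.sqrt (t - s)) A ;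
  bm_independent : forall t : nat -> R, 0 <= t 0%N ->
    (forall i : nat, t i <= t i.+1) ->
    mutually_independent P
      (fun i : nat => sigma_rv (fun w => W (t i.+1) w - W (t i) w)) }.

(* A homogeneous Poisson process of rate r, given by its event times: ev n is
   the time of the n-th event for n >= 1, and ev 0 = 0 is not an event.  The
   waiting times ev n.+1 - ev n are i.i.d. exponential.  Every realization is an
   infinite strictly increasing sequence with finitely many events in each
   bounded interval. *)
Record homogeneous_poisson_process (r : R) (ev : nat -> {RV P >-> R}) :
    Prop := {
  pp_start : forall w, ev 0%N w = 0 ;
  pp_increasing : forall n w, ev n w < ev n.+1 w ;
  pp_locally_finite : forall w (t : R), exists n, t < ev n w ;
  pp_exponential : forall n (A : set R), measurable A ->
    P ((fun w => ev n.+1 w - ev n w) @^-1` A) = exponential_prob r A ;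
  pp_independent : mutually_independent P
    (fun n : nat => sigma_rv (fun w => ev n.+1 w - ev n w)) }.

(* X is Brownian motion with resetting to xR at the events of ev, started at
   eta.  The Brownian motion W = B 0 drives X before the first event, and a
   fresh Brownian motion B n drives it from the n-th event until the next. *)
Record brownian_resetting (r xR : R) (eta : {RV P >-> R})
    (B : nat -> R -> {RV P >-> R}) (ev : nat -> {RV P >-> R})
    (X : R -> T -> R) : Prop := {
  reset_brownian : forall n, standard_brownian_motion (B n) ;
  reset_poisson : homogeneous_poisson_process r ev ;
  reset_independent : mutually_independent P (fun i : nat =>
    match i with
    | 0 => sigma_rv eta
    | 1 => sigma_process setT (fun n => ev n : T -> R)
    | n.+2 => sigma_process `[0, +oo[ (fun t => B n t : T -> R)
    end) ;
  reset_initial : forall w (t : R), 0 <= t < ev 1%N w ->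
    X t w = eta w + B 0%N t w ;
  reset_restart : forall w (t : R) (n : nat), (1 <= n)%N ->
    ev n w <= t < ev n.+1 w ->
    X t w = xR + B n (t - ev n w) w }.

(* The first-exit time from (0,b), equal to +oo when there is no exit. *)
Definition first_exit_time (b : R) (X : R -> T -> R) (w : T) : \bar R :=
  ereal_inf [set t%:E | t in [set t : R | 0 < t /\ ~ (0 < X t w < b)]].

Definition has_density (eta : {RV P >-> R}) (D : set R) (g : R -> R) : Prop :=
  forall A : set R, measurable A ->
    P (eta @^-1` A) = (\int[lebesgue_measure]_(x in A `&` D) (g x)%:E)%E.

End Processes.

Section InverseProblem.
Context (R : realType).
Local Notation mu := (@lebesgue_measure R).

(* Values outside D are irrelevant. *)
Definition is_density (D : set R) (g : R -> R) : Prop :=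
  [/\ measurable_fun D g,
      forall x, D x -> 0 <= g x &
      (\int[mu]_(x in D) (g x)%:E = 1)%E].

Definition cdf_pos (f : R -> R) (t : R) : R := \int[mu]_(s in `]0, t]) f s.

(* g solves the inverse first-exit time problem for the FPT density f: for
   every realization of the resetting process whose initial position has
   density g, the first-exit time has distribution function cdf_pos f. *)
Definition inverse_fet_solution (b r xR : R) (f g : R -> R) : Prop :=
  is_density `]0, b[ g /\
  forall (d : measure_display) (T : measurableType d) (P : probability T R)
    (eta : {RV P >-> R}) (B : nat -> R -> {RV P >-> R})
    (ev : nat -> {RV P >-> R}) (X : R -> T -> R),
  brownian_resetting r xR eta B ev X ->
  has_density eta `]0, b[ g ->
  forall t : R, 0 < t ->
    P [set w | (first_exit_time b X w <= t%:E)%E] = (cdf_pos f t)%:E.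

Definition laplace (D : set R) (g : R -> R) (s : R) : R :=
  \int[mu]_(x in D) (expR (- s * x) * g x).

Definition sinh (x : R) : R := (expR x - expR (- x)) / 2.

(* In alpha and f_hat the rate, the reset position and the width are
   fixed: r = 1, xR = 1/2 and b = 1. *)
Definition alpha (l : R) : R := Num.sqrt (2 * (l + 1)).

Definition J (k : nat) (s : R) : R :=
  \int[mu]_(x in `[0, 1]) (expR (- s * x) * x ^+ k).

Definition g_hat (k : nat) (s : R) : R :=
  (2 * k + 1)`!%:R / k`!%:R ^+ 2
    * \sum_(i < k.+1) (-1) ^+ i * 'C(k, i)%:R * J (k + i) s.

Definition f_hat (k : nat) (l : R) : R :=
  (2 * sinh (alpha l / 2) + l * (expR (alpha l) - 1) * g_hat k (alpha l))
    / (l * sinh (alpha l) + 2 * sinh (alpha l / 2)).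

Definition g_beta (k : nat) (x : R) : R :=
  (2 * k + 1)`!%:R / k`!%:R ^+ 2 * x ^+ k * (1 - x) ^+ k.

End InverseProblem.

(* Main.v *)
Require Import Defs.
From HB Require Import structures.
From mathcomp Require Import all_boot all_order all_algebra.
From mathcomp Require Import all_classical all_reals all_analysis.
From mathcomp Require Import unstable measurable_realfun.
From mathcomp Require Import ring lra.

Set Implicit Arguments.
Unset Strict Implicit.
Unset Printing Implicit Defensive.

Import Order.TTheory GRing.Theory Num.Theory.
Import numFieldNormedType.Exports.

Local Open Scope classical_set_scope.
Local Open Scope ring_scope.

(** The quantity computed is the discounted exit time [hit (exits X)], the
    number e^(-tau) with value 0 when tau = +oo.  It lies in [0, 1], and
    [{tau <= t}] is the event [e^(-t) <= e^(-tau)], so the law of tau is known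
    once the moments E[e^(-l tau)] are known for all natural numbers l: this is
    the uniqueness of the moment problem on a bounded interval
    ([moments_tail]).  Those of the density f are the values at l of its
    Laplace transform, so everything reduces to the formula [exit_moments].

    The resetting times cut the path into cycles.  In cycle k a Brownian motion
    starts at S_k, which is eta for k = 0 and 1/2 afterwards, and races against
    an exponential clock T_k.  Let V_k be the discounted exit time of that
    Brownian motion, had it run for ever, and U_k = e^(-T_k).  The exit happens
    in cycle n when V_k <= U_k for all k < n and U_n < V_n, and then
    e^(-tau) = U_0 ... U_(n-1) V_n ([hit_exits_cycles]).  The cycles are
    independent ([cycle_events_indep]) and so are V_k and T_k; therefore, with
    m_k = E[V_k^(l+1)],
      E[V_k^l ; U_k < V_k] = m_k,   E[U_k^l ; V_k <= U_k] = (1 - m_k) / (l+1),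
    and m_k = m does not depend on k >= 1.  A geometric series yields
      E[e^(-l tau)] = (l m_0 + m) / (l + m).

    It remains to know m_k, for which [hit_exits_transform] states the classical
    identity, with a = sqrt(2(l+1)),
      cosh(a/2) E[V_k^(l+1)] = E[cosh(a (S_k - 1/2))],
    optional stopping for the martingale e^(-(l+1)t) cosh(a (S_k + B_t - 1/2)).
    Only elementary stopping is used: the path is sampled at a mesh h and
    stopped when it first leaves [del, 1 - del].  A step that leaves this
    interval overshoots [0, 1] only if it is larger than del, which the Gaussian
    moment generating function makes negligible, even summed over all steps, as
    h -> 0 ([discount_bounds], [cvg_overshoot]).  Letting h -> 0 and then
    del -> 0 gives the identity, by continuity of the path alone.

    For a symmetric density on (0, 1) such as the Beta densities, the right-hand
    side is e^(a/2) times the Laplace transform at a ([cosh_transform_g_beta]).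
    Substituting m = 1 / cosh(a/2) and m_0 in the formula for E[e^(-l tau)]
    gives exactly the mixture of the [f_hat k l] ([mixture_f_hat]). *)

(** * Densities and bounded random variables *)

Section Density.
Local Open Scope ereal_scope.
Context d (T : measurableType d) (R : realType).
Variables (m mu : {measure set T -> \bar R}) (g : T -> R).
Hypothesis mg : measurable_fun setT g.
Hypothesis g_ge0 : forall x, (0 <= g x)%R.
Hypothesis m_density :
  forall A, measurable A -> m A = \int[mu]_(x in A) (g x)%:E.

Import HBNNSimple.

(** Both sides are linear and continuous along increasing sequences in h, and
    they agree on indicators by hypothesis. *)
Lemma ge0_integral_density (h : T -> \bar R) :
  measurable_fun setT h -> (forall x, 0 <= h x) ->
  \int[m]_x h x = \int[mu]_x (h x * (g x)%:E).
Proof.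
move=> mh h_ge0; pose a := nnsfun_approx measurableT mh.
have a_cvg x : (a n x)%:E @[n --> \oo] --> h x by exact: cvg_nnsfun_approx.
have a_nd x : {homo (fun n => (a n x)%:E) : p q / (p <= q)%N >-> p <= q}.
  by move=> p q pq; rewrite lee_fin; exact/lefP/nd_nnsfun_approx.
have mag n : measurable_fun setT (fun x => (a n x)%:E * (g x)%:E).
  apply: emeasurable_funM; first exact/measurable_EFinP/measurable_funP.
  exact/measurable_EFinP.
transitivity (limn (fun n => \int[m]_x (a n x)%:E)).
  rewrite -monotone_convergence//.
  - by apply: eq_integral => x _; apply/esym/cvg_lim.
  - by move=> n; exact/measurable_EFinP/measurable_funP.
  - by move=> n x _; rewrite lee_fin.
transitivity (limn (fun n => \int[mu]_x ((a n x)%:E * (g x)%:E))); last first.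
  rewrite -monotone_convergence//.
  - apply: eq_integral => x _; apply/cvg_lim => //.
    by under eq_fun do rewrite muleC; rewrite muleC; exact: cvgeZl.
  - by move=> n x _; rewrite mule_ge0// lee_fin.
  - by move=> x _ p q pq; rewrite lee_wpmul2r ?lee_fin// -lee_fin; exact: a_nd.
congr (limn _); apply/funext => n.
have mpre r : measurable (a n @^-1` [set r]) by [].
have mterm r : measurable_fun setT (fun x => (r * \1_(a n @^-1` [set r]) x)%:E).
  by apply/measurable_EFinP; apply: measurable_funM.
under eq_integral do rewrite fimfunE -fsumEFin//.
rewrite ge0_integral_fsum//;
  last by move=> r x _; rewrite EFinM nnfun_muleindic_ge0.
under [RHS]eq_integral.
  move=> x _; rewrite fimfunE -fsumEFin// ge0_mule_fsuml; last first.
    by move=> r; rewrite EFinM nnfun_muleindic_ge0.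
  over.
rewrite ge0_integral_fsum//; last 2 first.
- by move=> r; apply: emeasurable_funM => //; exact/measurable_EFinP.
- by move=> r x _; rewrite mule_ge0 ?EFinM ?nnfun_muleindic_ge0 ?lee_fin.
apply: eq_fsbigr => r /[!inE] -[y _ <-].
rewrite integralZl_indic_nnsfun// integral_indic// setIT m_density//.
under [RHS]eq_integral do rewrite EFinM -muleA.
rewrite ge0_integralZl//.
- congr (_ * _); rewrite integral_mkcond; apply: eq_integral => x _.
  rewrite indicE patchE; case: ifPn => _; rewrite ?mul1e ?mul0e//.
- by apply: emeasurable_funM; apply/measurable_EFinP.
- by move=> x _; rewrite mule_ge0// lee_fin.
- by rewrite lee_fin.
Qed.

End Density.

Section RealIntegral.
Context d (T : measurableType d) (R : realType) (P : probability T R).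

Lemma bounded_integrable (D : set T) (X : T -> R) (M : R) : measurable D ->
  measurable_fun D X -> (forall w, `|X w| <= M) ->
  P.-integrable D (EFin \o X).
Proof.
move=> mD mX XM; apply: measurable_bounded_integrable => //.
  by rewrite (le_lt_trans (probability_le1 P mD)) ?ltry.
exists M; split; first by rewrite num_real.
by move=> x Mx w _; apply: le_trans (XM w) (ltW Mx).
Qed.

Lemma ge0_Rintegral_fineK (X : T -> R) (M : R) :
  measurable_fun setT X -> (forall w, 0 <= X w <= M) ->
  (\int[P]_w (X w)%:E = (\int[P]_w X w)%:E)%E.
Proof.
move=> mX XM; rewrite fineK//; apply: integrable_fin_num => //.
apply: (bounded_integrable (M := M)) => // w.
by have /andP[X0 XM'] := XM w; rewrite ger0_norm.
Qed.

Lemma cvg_Rintegral_bounded (X : nat -> T -> R) (Y : T -> R) (M : R) :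
  (forall n, measurable_fun setT (X n)) -> measurable_fun setT Y ->
  (forall n w, `|X n w| <= M) -> (forall w, X n w @[n --> \oo] --> Y w) ->
  \int[P]_w X n w @[n --> \oo] --> \int[P]_w Y w.
Proof.
move=> mX mY XM XY.
have iM : P.-integrable setT (EFin \o cst M).
  apply: (bounded_integrable (M := `|M|)) => //.
have mEX n : measurable_fun setT (EFin \o X n) by exact/measurable_EFinP.
have mEY : measurable_fun setT (EFin \o Y) by exact/measurable_EFinP.
have XYE w : setT w -> (EFin \o X n) w @[n --> \oo] --> (EFin \o Y) w.
  by move=> _; apply: cvg_EFin; [exact: nearW|exact: XY].
have [iY _ XcY] := dominated_convergence measurableT mEX mEY (aeW _ XYE) iM
  (aeW _ (fun w n _ => XM n w)).
by apply: fine_cvg; rewrite fineK//; exact: integrable_fin_num.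
Qed.

End RealIntegral.

Section RandomVariableDensity.
Context d (T : measurableType d) (R : realType) (P : probability T R).

(** The law of X lives on the real line with the same measurable sets as the
    Lebesgue measure; X is repackaged with that target so that the two measures
    have the same type. *)
Lemma ge0_integral_rv_density (X : T -> R) (g : R -> R) (h : R -> \bar R) :
  measurable_fun setT X -> measurable_fun setT g -> (forall x, 0 <= g x) ->
  (forall A, measurable A ->
    P (X @^-1` A) = \int[lebesgue_measure]_(x in A) (g x)%:E)%E ->
  measurable_fun setT h -> (forall x, 0 <= h x)%E ->
  (\int[P]_w h (X w) = \int[lebesgue_measure]_x (h x * (g x)%:E))%E.
Proof.
move=> mX mg g0 Xg mh h0.
pose X' : {mfun T >-> measurableTypeR R} :=
  HB.pack (X : T -> measurableTypeR R)
    (isMeasurableFun.Build _ _ _ (measurableTypeR R) X mX).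
rewrite -(@ge0_integral_density _ _ _ (distribution P X')
  (@lebesgue_measure R) g mg g0 Xg)//.
by rewrite ge0_integral_distribution.
Qed.

End RandomVariableDensity.

(** * Independence *)

Section Independence.
Context d (T : measurableType d) (R : realType) (P : probability T R).
Implicit Types (G F : set (set T)) (A B : set T).

(** A sigma-algebra coarser than the ambient one is carried by a copy of the
    type T. *)
Definition adapted G (X : T -> R) :=
  measurable_fun setT (X : g_sigma_algebraType G -> R).

Lemma sub_sigma_measurable G : G `<=` measurable -> <<s G >> `<=` measurable.
Proof.
move=> Gm; apply: smallest_sub => //.
exact: sigma_algebra_measurable.
Qed.

Lemma adapted_measurable G (X : T -> R) :
  G `<=` measurable -> adapted G X -> measurable_fun setT X.
Proof.
move=> Gm GX _ A mA; rewrite setTI; apply: (sub_sigma_measurable Gm).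
by have := GX measurableT A mA; rewrite setTI.
Qed.

Lemma adapted_preimage G (X : T -> R) C :
  adapted G X -> measurable C -> <<s G >> (X @^-1` C).
Proof. by move=> GX mC; have := GX measurableT C mC; rewrite setTI. Qed.

Lemma sub_adapted G F (X : T -> R) : G `<=` <<s F >> -> adapted G X ->
  adapted F X.
Proof.
move=> GF GX _ C mC; rewrite setTI.
suff : <<s G >> `<=` <<s F >> by apply; exact: adapted_preimage.
by apply: smallest_sub => //; exact: smallest_sigma_algebra.
Qed.

(** Both sides of the product rule are additive in one event, so the events
    that obey it form a Dynkin system: the rule spreads from a pi-system to the
    sigma-algebra that it generates. *)
Lemma indep_sigma G B : measurable B -> G `<=` measurable -> setI_closed G ->
  (forall A, G A -> P (A `&` B) = (P A * P B)%E) ->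
  forall A, <<s G >> A -> P (A `&` B) = (P A * P B)%E.
Proof.
move=> mB Gm GI GB A; rewrite -setI_closed_g_dynkin_g_sigma_algebra// => GA.
suff : <<d G >> `<=` [set A | measurable A /\ P (A `&` B) = (P A * P B)%E].
  by move=> /(_ _ GA)[].
apply: smallest_sub => [|C GC]; last by split; [exact: Gm|exact: GB].
split => [|C [mC CB]|C tC CB].
- by split=> //; rewrite setTI probability_setT mul1e.
- split; first exact: measurableC.
  rewrite setIC -setDE measureD//; last first.
    by rewrite (le_lt_trans (probability_le1 P mB)) ?ltry.
  rewrite probability_setC// setIC.
  transitivity (P B - P C * P B)%E; first by congr (_ - _)%E.
  by rewrite muleBl ?mul1e// fin_num_measure.
- split; first by apply: bigcup_measurable => n _; case: (CB n).
  rewrite setI_bigcupl measure_bigcup//; last 2 first.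
  + by move=> n _; apply: measurableI => //; case: (CB n).
  + exact: trivIset_setIr.
  rewrite measure_bigcup//; last by move=> n _; case: (CB n).
  have seriesZr (Q : pred nat) (b : \bar R) (u : (\bar R)^nat) :
    b \is a fin_num ->
      (forall n, 0 <= u n)%E ->
      (\sum_(n <oo | Q n) u n * b = (\sum_(n <oo | Q n) u n) * b)%E.
    case: b => // b _ u0; rewrite muleC -nneseriesZl//.
    by apply: eq_eseriesr => n _; rewrite muleC.
  rewrite -[RHS]seriesZr ?fin_num_measure//.
  by apply: eq_eseriesr => n _; case: (CB n).
Qed.

Lemma sigma_rv_measurable (X : T -> R) :
  measurable_fun setT X -> sigma_rv X `<=` measurable.
Proof. by move=> mX _ [A mA <-]; exact: mX. Qed.

Lemma sigma_rvI (X : T -> R) : setI_closed (sigma_rv X).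
Proof.
move=> _ _ [A mA <-] [B mB <-]; exists (A `&` B); first exact: measurableI.
by rewrite !setTI preimage_setI.
Qed.

Lemma sigma_rvT (X : T -> R) : sigma_rv X setT.
Proof. by exists setT => //; rewrite setTI preimage_setT. Qed.

Lemma adapted_sub (G : set (set T)) (X : T -> R) :
  sigma_rv X `<=` <<s G >> -> adapted G X.
Proof. by move=> XG _ A mA; apply: XG; exists A. Qed.

End Independence.

Section JointLaw.
Context d (T : measurableType d) (R : realType) (P : probability T R).

Definition mfun_of (X : T -> R) (mX : measurable_fun setT X) : {mfun T >-> R} :=
  HB.pack X (isMeasurableFun.Build _ _ _ _ X mX).

(** The product rule on rectangles identifies the joint law with the product of
    the laws; the rest is Tonelli's theorem. *)
Lemma ge0_integral_indep_pair (X Y : {mfun T >-> R}) (h : R * R -> \bar R) :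
  (forall A B, measurable A -> measurable B ->
    P (X @^-1` A `&` Y @^-1` B) = (P (X @^-1` A) * P (Y @^-1` B))%E) ->
  measurable_fun setT h -> (forall z, 0 <= h z)%E ->
  (\int[P]_w h (X w, Y w) =
   \int[distribution P X]_x \int[distribution P Y]_y h (x, y))%E.
Proof.
move=> XY mh h0; pose Z w := (X w, Y w).
have mZ : measurable_fun setT Z by apply: measurable_fun_pair.
pose Zf : {mfun T >-> (R * R)%type} :=
  HB.pack Z (isMeasurableFun.Build _ _ _ _ Z mZ).
transitivity (\int[distribution P Zf]_z h z)%E.
  by rewrite ge0_integral_distribution.
transitivity (\int[distribution P X \x distribution P Y]_z h z)%E; last first.
  by rewrite fubini_tonelli1.
apply: eq_measure_integral => A mA _; apply/esym.
exact: product_measure_unique.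
Qed.

(** The positive part extends the integrand (x, y) |-> x y from the values
    actually taken to a nonnegative function on the whole plane. *)
Lemma ge0_integral_indepM (X Y : {mfun T >-> R}) :
  (forall A B, measurable A -> measurable B ->
    P (X @^-1` A `&` Y @^-1` B) = (P (X @^-1` A) * P (Y @^-1` B))%E) ->
  (forall w, 0 <= X w) -> (forall w, 0 <= Y w) ->
  (\int[P]_w (X w * Y w)%:E = (\int[P]_w (X w)%:E) * \int[P]_w (Y w)%:E)%E.
Proof.
move=> XY X0 Y0.
pose pos (x : R) := Num.max x 0.
have mpos : measurable_fun setT pos by exact: measurable_maxr.
have posE x : 0 <= x -> pos x = x by move=> x0; rewrite /pos max_l.
have pos0 x : 0 <= pos x by rewrite le_max lexx orbT.
transitivity (\int[P]_w (pos (X w) * pos (Y w))%:E)%E.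
  by apply: eq_integral => w _; rewrite !posE.
rewrite (ge0_integral_indep_pair (h := fun z => (pos z.1 * pos z.2)%:E))//;
  last 2 first.
- apply/measurable_EFinP; apply: measurable_funM.
    exact: measurableT_comp.
  exact: measurableT_comp.
- by move=> z; rewrite lee_fin mulr_ge0.
have mposE : measurable_fun setT (EFin \o pos) by exact/measurable_EFinP.
have pos0E x : (0 <= (EFin \o pos) x)%E by rewrite lee_fin.
have Epos (Z : {mfun T >-> R}) : (forall w, 0 <= Z w) ->
    (\int[distribution P Z]_x (EFin \o pos) x = \int[P]_w (Z w)%:E)%E.
  move=> Z0; rewrite ge0_integral_distribution//.
  by apply: eq_integral => w _; rewrite /= posE.
transitivity
  (\int[distribution P X]_x ((EFin \o pos) x * \int[P]_w (Y w)%:E))%E.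
  apply: eq_integral => x _; rewrite -Epos// -ge0_integralZl ?lee_fin//.
rewrite ge0_integralZr// ?Epos//.
by apply: integral_ge0 => w _; rewrite lee_fin.
Qed.

End JointLaw.

Section Cylinders.
Context d (T : measurableType d) (R : realType) (P : probability T R).
Implicit Types (F : nat -> set (set T)) (A B : set T).

(** The finite intersections of events from the first n families: a pi-system
    that generates the past before the n-th family. *)
Definition cylinder F n : set (set T) :=
  [set A | exists2 E : nat -> set T, (forall i, (i < n)%N -> F i (E i)) &
    A = \big[setI/setT]_(i < n) E i].

Definition indep_seq F : Prop := forall n (E : nat -> set T),
  (forall i, (i < n)%N -> F i (E i)) ->
  P (\big[setI/setT]_(i < n) E i) = (\prod_(i < n) P (E i))%E.

Lemma cylinderI F n : (forall i, setI_closed (F i)) ->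
  setI_closed (cylinder F n).
Proof.
move=> FI _ _ [E1 FE1 ->] [E2 FE2 ->]; exists (fun i => E1 i `&` E2 i).
  by move=> i ni; apply: FI; [exact: FE1|exact: FE2].
by rewrite big_split.
Qed.

Lemma cylinder_coord F n i A : (forall j, F j setT) -> (i < n)%N ->
  F i A -> cylinder F n A.
Proof.
move=> FT ni FA; exists (fun j => if j == i then A else setT).
  by move=> j _; case: eqP => [->|].
rewrite (bigD1 (Ordinal ni))//= eqxx big1 ?setIT// => j /negP ji.
by case: eqP => // jE; exfalso; apply: ji; apply/eqP/val_inj.
Qed.

Lemma cylinder_measurable F n : (forall i, F i `<=` measurable) ->
  cylinder F n `<=` measurable.
Proof.
move=> Fm _ [E FE ->]; apply: bigsetI_measurable => i _.
exact/Fm/FE.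
Qed.

(** Two applications of the extension from pi-systems, once on each side. *)
Lemma indep_past F n A B : indep_seq F -> (forall i, F i `<=` measurable) ->
  (forall i, setI_closed (F i)) ->
  <<s cylinder F n >> A -> <<s F n >> B -> P (A `&` B) = (P A * P B)%E.
Proof.
move=> Find Fm FI sA sB.
have mB : measurable B by exact: (sub_sigma_measurable (@Fm n)).
apply: (indep_sigma mB (cylinder_measurable Fm) (cylinderI FI)) sA => C CC.
have mC : measurable C by exact: (cylinder_measurable Fm) CC.
rewrite setIC muleC; apply: (indep_sigma mC (@Fm n) (@FI n)) sB => D FD.
case: CC => E FE CE; pose E' i := if i == n then D else E i.
have E'n : E' n = D by rewrite /E' eqxx.
have E'E (i : 'I_n) : E' i = E i by rewrite /E' ltn_eqF.
have EC : \big[setI/setT]_(i < n) E' i = C.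
  by rewrite CE; apply: eq_bigr => i _; rewrite E'E.
have PC : (\prod_(i < n) P (E' i) = P C)%E.
  by rewrite CE Find//; apply: eq_bigr => i _; rewrite E'E.
have := Find n.+1 E'; rewrite !big_ord_recr/= EC PC E'n setIC muleC; apply.
move=> i; rewrite ltnS leq_eqVlt /E'; case: eqP => [->//|_] /= ni; exact: FE.
Qed.

End Cylinders.

(** * Gaussian moments and the hyperbolic cosine *)

Section GaussianMoments.
Context (R : realType).

(** Completing the square: an exponential tilt shifts the mean. *)
Lemma normal_expR_pdf (s th x : R) : s != 0 ->
  expR (th * x) * normal_pdf 0 s x =
  expR (th ^+ 2 * s ^+ 2 / 2) * normal_pdf (th * s ^+ 2) s x.
Proof.
move=> s0; rewrite !normal_pdfE// /normal_fun.
rewrite mulrCA [RHS]mulrCA -!expRD; congr (_ * expR _).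
by rewrite subr0; field.
Qed.

Lemma normal_rv_mgf d (T : measurableType d) (P : probability T R)
    (X : T -> R) (s th : R) : s != 0 -> measurable_fun setT X ->
  (forall A, measurable A -> P (X @^-1` A) = normal_prob 0 s A) ->
  (\int[P]_w (expR (th * X w))%:E = (expR (th ^+ 2 * s ^+ 2 / 2))%:E)%E.
Proof.
move=> s0 mX XE.
rewrite (ge0_integral_rv_density (g := normal_pdf 0 s)
  (h := fun x => (expR (th * x))%:E) mX)//; last 3 first.
- exact: measurable_normal_pdf.
- by move=> x; exact: normal_pdf_ge0.
- by apply/measurable_EFinP; apply: measurableT_comp.
under eq_integral do rewrite -EFinM normal_expR_pdf// EFinM.
rewrite ge0_integralZl//.
- by rewrite integral_normal_pdf mule1.
- by apply/measurable_EFinP; exact: measurable_normal_pdf.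
- by move=> x _; rewrite lee_fin normal_pdf_ge0.
Qed.

End GaussianMoments.

Section Cosh.
Context (R : realType).
Implicit Types a x y : R.

Definition cosh y : R := (expR y + expR (- y)) / 2.

Lemma cosh_ge0 y : 0 <= cosh y.
Proof. by rewrite /cosh divr_ge0// addr_ge0// expR_ge0. Qed.

Lemma cosh_gt0 y : 0 < cosh y.
Proof. by rewrite /cosh divr_gt0// addr_gt0// expR_gt0. Qed.

Lemma cosh_abs y : cosh `|y| = cosh y.
Proof. by case: ger0P => // _; rewrite /cosh opprK addrC. Qed.

Lemma le_cosh x y : `|x| <= `|y| -> cosh x <= cosh y.
Proof.
rewrite -(cosh_abs x) -(cosh_abs y); move: (normr_ge0 x).
move: `|x| `|y| => {}x {}y x0 xy; rewrite /cosh ler_pM2r// -subr_ge0.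
rewrite (_ : _ - _ = (expR y - expR x) * (1 - expR (- x - y))).
  by rewrite mulr_ge0// subr_ge0 ?ler_expR// -expR0 ler_expR; lra.
rewrite mulrBr mulr1 mulrBl -!expRD.
have -> : y + (- x - y) = - x by ring.
have -> : x + (- x - y) = - y by ring.
by ring.
Qed.

Lemma cosh_le_expR y : cosh y <= expR `|y|.
Proof.
rewrite -cosh_abs /cosh.
have : expR (- `|y|) <= expR `|y| by rewrite ler_expR ge0_cp.
by lra.
Qed.

Lemma measurable_cosh : measurable_fun setT cosh.
Proof.
apply: measurable_funM => //; apply: measurable_funD => //.
by apply: measurableT_comp.
Qed.

End Cosh.

(** * A Brownian path sampled on a mesh *)

Section SampledPath.
Context d (T : measurableType d) (R : realType) (P : probability T R).
Variables (S0 : T -> R) (W : R -> {RV P >-> R}) (h : R).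
Hypothesis mS0 : measurable_fun setT S0.
Hypothesis W_bm : standard_brownian_motion W.
Hypothesis S0_W : forall A E, measurable A ->
  sigma_process `[0, +oo[ (fun t => W t : T -> R) E ->
  P (S0 @^-1` A `&` E) = (P (S0 @^-1` A) * P E)%E.
Hypothesis h_gt0 : 0 < h.

Let time (k : nat) : R := k%:R * h.
Definition step (k : nat) (w : T) : R := W (time k.+1) w - W (time k) w.
Definition sample (k : nat) (w : T) : R := S0 w + W (time k) w.

Let time_ge0 k : 0 <= time k. Proof. by rewrite mulr_ge0// ltW. Qed.

Lemma sampleS k w : sample k.+1 w = sample k w + step k w.
Proof. by rewrite /sample /step; ring. Qed.

Lemma sample0 w : sample 0 w = S0 w.
Proof. by rewrite /sample /time mul0r (bm_start W_bm) addr0. Qed.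

(** Family 0 carries the starting point and family k+1 the k-th step, so that
    the cylinders of the first k+1 families generate the path up to time k. *)
Definition step_events (i : nat) : set (set T) :=
  if i is k.+1 then sigma_rv (step k) else sigma_rv S0.

Lemma measurable_step k : measurable_fun setT (step k).
Proof. exact: measurable_funB. Qed.

Lemma measurable_sample k : measurable_fun setT (sample k).
Proof. exact: measurable_funD. Qed.

Lemma step_eventsI i : setI_closed (step_events i).
Proof. by case: i => [|i]; exact: sigma_rvI. Qed.

Lemma step_eventsT i : step_events i setT.
Proof. by case: i => [|i]; exact: sigma_rvT. Qed.

Lemma step_events_measurable i : step_events i `<=` measurable.
Proof.
by case: i => [|i]; apply: sigma_rv_measurable => //; exact: measurable_step.
Qed.

Lemma step_process k : sigma_rv (step k) `<=`
  sigma_process `[0, +oo[ (fun t => W t : T -> R).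
Proof.
have adW t : 0 <= t ->
  adapted (\bigcup_(t in `[0, +oo[) sigma_rv (W t : T -> R)) (W t).
  move=> t0; apply: adapted_sub => A WA; apply: sub_sigma_algebra.
  by exists t => //=; rewrite in_itv/= t0.
move=> _ [A mA <-]; rewrite setTI; apply: adapted_preimage => //.
by apply: measurable_funB; exact: adW.
Qed.

Lemma step_events_indep : indep_seq P step_events.
Proof.
move=> [|n] E FE; first by rewrite !big_ord0 probability_setT.
rewrite !big_ord_recl /=.
have [A mA <-] := FE 0 (ltn0Sn _); rewrite setTI S0_W//; last first.
  apply: (@bigsetI_measurable _ (g_sigma_algebraType
    (\bigcup_(t in `[0, +oo[) sigma_rv (W t : T -> R)))) => i _.
  by apply: (@step_process i); apply: (FE i.+1); rewrite ltnS.
congr (_ * _)%E.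
have := @bm_independent _ _ _ _ _ W_bm time (time_ge0 0) _ (index_iota 0 n)
  (fun i => E i.+1) (iota_uniq 0 (n - 0)).
rewrite bigcap_seq !big_mkord; apply => [i|i].
  by rewrite ler_wpM2r ?ler_nat// ltW.
by rewrite mem_index_iota /= => ni; apply: (FE i.+1); rewrite ltnS.
Qed.

Let past k := cylinder step_events k.+1.

Lemma past_coord k i : (i <= k)%N -> step_events i `<=` <<s past k >>.
Proof.
move=> ik A sA; apply: sub_sigma_algebra.
exact: (cylinder_coord step_eventsT _ sA).
Qed.

Lemma adapted_sample j k : (j <= k)%N -> adapted (past k) (sample j).
Proof.
elim: j => [_|j IHj jk].
  rewrite (_ : sample 0 = S0); last by apply/funext => w; exact: sample0.
  by apply: adapted_sub; exact: (@past_coord k 0).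
rewrite (_ : sample j.+1 = fun w => sample j w + step j w); last first.
  by apply/funext => w; exact: sampleS.
apply: measurable_funD; first exact: IHj (ltnW jk).
by apply: adapted_sub; exact: (@past_coord k j.+1).
Qed.

Lemma step_normal k A : measurable A ->
  P (step k @^-1` A) = normal_prob 0 (Num.sqrt h) A.
Proof.
move=> mA; have ltk : time k < time k.+1 by rewrite ltr_pM2r// ltr_nat.
have := bm_normal W_bm (time_ge0 k) ltk mA.
by rewrite (_ : time k.+1 - time k = h)// /time; ring.
Qed.

Lemma step_mgf k th :
  (\int[P]_w (expR (th * step k w))%:E = (expR (th ^+ 2 * h / 2))%:E)%E.
Proof.
rewrite (normal_rv_mgf _ _ (measurable_step k) (@step_normal k)) ?sqr_sqrtr
  ?ltW//.
by rewrite gt_eqF// sqrtr_gt0.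
Qed.

(** The step k is Gaussian and independent of the past, so the exponential
    factor integrates out. *)
Lemma integral_past_step k (Y : T -> R) th : adapted (past k) Y ->
  (forall w, 0 <= Y w) ->
  (\int[P]_w (Y w * expR (th * step k w))%:E =
   (\int[P]_w (Y w)%:E) * (expR (th ^+ 2 * h / 2))%:E)%E.
Proof.
move=> aY Y0; rewrite -(step_mgf k).
have mY : measurable_fun setT Y.
  exact: adapted_measurable (cylinder_measurable step_events_measurable) aY.
have mexp : measurable_fun setT (fun w => expR (th * step k w)).
  apply: measurableT_comp => //; apply: measurable_funM => //.
  exact: measurable_step.
apply: (@ge0_integral_indepM _ _ _ P (mfun_of mY) (mfun_of mexp)) => //=.
move=> A B mA mB.
apply: (indep_past step_events_indep step_events_measurable step_eventsI
  (n := k.+1)).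
  exact: adapted_preimage.
apply: adapted_preimage => //.
have astep : adapted (step_events k.+1) (step k).
  by apply: adapted_sub; exact: sub_sigma_algebra.
by apply: measurableT_comp => //; apply: measurable_funM.
Qed.

End SampledPath.

(** * The first escape of the sampled path *)

Section SampledExit.
Context d (T : measurableType d) (R : realType) (P : probability T R).
Variables (S0 : T -> R) (W : R -> {RV P >-> R}) (h : R).
Hypothesis mS0 : measurable_fun setT S0.
Hypothesis W_bm : standard_brownian_motion W.
Hypothesis S0_W : forall A E, measurable A ->
  sigma_process `[0, +oo[ (fun t => W t : T -> R) E ->
  P (S0 @^-1` A `&` E) = (P (S0 @^-1` A) * P E)%E.
Hypothesis h_gt0 : 0 < h.
Hypothesis S0_in : forall w, 0 < S0 w < 1.
Variables (del al gam : R).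
Hypotheses (del_gt0 : 0 < del) (del_lt : 2 * del < 1).
Hypotheses (al_ge0 : 0 <= al) (gam_ge0 : 0 <= gam).

Local Notation S := (sample S0 W h).
Local Notation xi := (step W h).

Let inI (x : R) : R := \1_(`[del, 1 - del]) x.
Let CC (x : R) : R := cosh (al * (x - 1 / 2)).
(* The cosine is at least [cl] outside [del, 1 - del] and at most [cu] on
   [0, 1]; [rho] bounds the mean excess over [cu] caused by one step. *)
Let cl : R := cosh (al * (1 / 2 - del)).
Let cu : R := cosh (al / 2).
Let rho : R := 2 * expR (al / 2 - gam * del) * expR ((al + gam) ^+ 2 * h / 2).
Let beta : R := expR (- (al ^+ 2 / 2) * h).

(** Indicators as products: [inside k] concerns the samples before the k-th only,
    so that [escape k] detects a first escape, at the k-th sample. *)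
Definition inside k w : R := \prod_(j < k) inI (S j w).
Definition escape k w : R := inside k w * (1 - inI (S k w)).

Let inIP x : (inI x = 1 /\ del <= x <= 1 - del) \/
  (inI x = 0 /\ ~ (del <= x <= 1 - del)).
Proof.
rewrite /inI indicE; case: (boolP (x \in _)) => xI; [left|right]; split => //.
  by move: xI; rewrite inE /= in_itv.
by move=> xI'; move/negP: xI; apply; rewrite inE /= in_itv.
Qed.

Let minI : measurable_fun setT inI. Proof. exact: measurable_indic. Qed.

Let mCC : measurable_fun setT CC.
Proof.
by apply: (measurableT_comp (@measurable_cosh R)); apply: measurable_funM => //;
  exact: measurable_funB.
Qed.

Let inside01 k w : inside k w = 0 \/ inside k w = 1.
Proof.
rewrite /inside; elim: k => [|k]; first by rewrite big_ord0; right.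
rewrite big_ord_recr /= => -[] ->; first by rewrite mul0r; left.
by rewrite mul1r; case: (inIP (S k w)) => -[-> _]; [right|left].
Qed.

Let inside0 w : inside 0 w = 1. Proof. by rewrite /inside big_ord0. Qed.

Let insideS k w : inside k.+1 w = inside k w * inI (S k w).
Proof. by rewrite /inside big_ord_recr. Qed.

Let inside_ge0 k w : 0 <= inside k w.
Proof. by case: (inside01 k w) => ->. Qed.

Let escape01 k w : escape k w = 0 \/
  (escape k w = 1 /\ inside k w = 1 /\ ~ (del <= S k w <= 1 - del)).
Proof.
rewrite /escape; case: (inside01 k w) => ->; first by rewrite mul0r; left.
by rewrite mul1r; case: (inIP (S k w)) => -[-> ?]; rewrite ?subrr ?subr0;
  [left|right].
Qed.

Let escape_ge0 k w : 0 <= escape k w.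
Proof. by case: (escape01 k w) => [->|[-> _]]. Qed.

Let mS k : measurable_fun setT (S k). Proof. exact: measurable_sample. Qed.

Let minside k : measurable_fun setT (inside k).
Proof.
by apply: measurable_prod => j _; apply: (measurableT_comp minI).
Qed.

Let mescape k : measurable_fun setT (escape k).
Proof.
apply: measurable_funM => //; apply: measurable_funB => //.
exact: (measurableT_comp minI).
Qed.

Let mCS k : measurable_fun setT (fun w => CC (S k w)).
Proof. exact: (measurableT_comp mCC). Qed.

Let CC_ge0 x : 0 <= CC x. Proof. exact: cosh_ge0. Qed.

Let CC_le x : 0 <= x <= 1 -> CC x <= cu.
Proof.
move=> x01; apply: le_cosh; rewrite !normrM ler_wpM2l//.
by rewrite (ger0_norm (_ : 0 <= 2^-1))// ler_norml; lra.
Qed.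

Let CC_ge x : ~ (del <= x <= 1 - del) -> cl <= CC x.
Proof.
have [d0 d1] := (del_gt0, del_lt).
move=> xI; apply: le_cosh; rewrite !normrM ler_wpM2l//.
rewrite (@ger0_norm _ (1 / 2 - del)); last by lra.
rewrite ler_normr; case: (ltP x del) => xd; first by apply/orP; right; lra.
case: (ltP (1 - del) x) => dx; first by apply/orP; left; lra.
by exfalso; apply: xI; rewrite xd dx.
Qed.

Let Cinside_le k w : 0 <= CC (S k w) * inside k.+1 w <= cu.
Proof.
rewrite mulr_ge0//= insideS; have [d0 d1] := (del_gt0, del_lt).
case: (inIP (S k w)) => -[-> SI].
  case: (inside01 k w) => ->; rewrite ?mul0r ?mulr0 ?mulr1 ?cosh_ge0//.
  by apply: CC_le; lra.
by rewrite !mulr0 cosh_ge0.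
Qed.

Let A k : R := \int[P]_w (CC (S k w) * inside k.+1 w).

Let A_ge0 k : 0 <= A k.
Proof. by apply: Rintegral_ge0 => w _; rewrite mulr_ge0. Qed.

Let AE k : (\int[P]_w (CC (S k w) * inside k.+1 w)%:E = (A k)%:E)%E.
Proof.
apply: (ge0_Rintegral_fineK _ (M := cu)) => //.
by apply: measurable_funM => //.
Qed.

Let A_le k : A k <= cu.
Proof.
rewrite -[leRHS]mulr1 -[X in _ <= _ * X](_ : fine (P setT) = 1); last first.
  by rewrite probability_setT.
rewrite -Rintegral_cst//; apply: le_Rintegral => //.
- apply: (bounded_integrable _ (M := cu)) => //; first exact: measurable_funM.
  by move=> w; have /andP[? ?] := Cinside_le k w; rewrite ger0_norm.
- apply: (bounded_integrable _ (M := cu)) => // w; rewrite ger0_norm//.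
  exact: cosh_ge0.
- by move=> w _; have /andP[] := Cinside_le k w.
Qed.

Let adapted_inside k : adapted (cylinder (step_events S0 W h) k.+1)
  (inside k.+1).
Proof.
apply: measurable_prod => j _; apply: (measurableT_comp minI).
by apply: adapted_sample => //; rewrite -ltnS.
Qed.

(** The hyperbolic cosine is the half-sum of two exponentials, and each of them
    gains the same factor beta^-1 over one step, because that factor depends
    only on the square of the exponent. *)
Let martingale k :
  (\int[P]_w (CC (S k.+1 w) * inside k.+1 w)%:E = (A k * beta^-1)%:E)%E.
Proof.
pose Y (e : R) w := expR (e * al * (S k w - 1 / 2)) / 2 * inside k.+1 w.
have Y0 e w : 0 <= Y e w by rewrite mulr_ge0// divr_ge0// expR_ge0.
have aY e : adapted (cylinder (step_events S0 W h) k.+1) (Y e).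
  apply: measurable_funM; last exact: adapted_inside.
  apply: measurable_funM => //; apply: measurableT_comp => //.
  apply: measurable_funM => //; apply: measurable_funB => //.
  exact: adapted_sample.
have mY e : measurable_fun setT (Y e).
  apply: measurable_funM => //.
  apply: measurable_funM => //; apply: measurableT_comp => //.
  by apply: measurable_funM => //; apply: measurable_funB.
have mE e : measurable_fun setT (fun w => Y e w * expR (e * al * xi k w)).
  apply: measurable_funM => //; apply: measurableT_comp => //.
  by apply: measurable_funM => //; exact: measurable_step.
transitivity (\int[P]_w ((Y 1 w * expR (1 * al * xi k w))%:E
    + (Y (-1) w * expR (-1 * al * xi k w))%:E))%E.
  apply: eq_integral => w _; rewrite -EFinD; congr EFin.
  rewrite (sampleS S0 W h k w) /Y /CC /cosh.
  have -> : expR (al * (S k w + xi k w - 1 / 2)) =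
      expR (1 * al * (S k w - 1 / 2)) * expR (1 * al * xi k w).
    by rewrite -expRD; congr expR; ring.
  have -> : expR (- (al * (S k w + xi k w - 1 / 2))) =
      expR (-1 * al * (S k w - 1 / 2)) * expR (-1 * al * xi k w).
    by rewrite -expRD; congr expR; ring.
  by ring.
rewrite ge0_integralD//; last 4 first.
- by move=> w _; rewrite lee_fin mulr_ge0// expR_ge0.
- exact/measurable_EFinP.
- by move=> w _; rewrite lee_fin mulr_ge0// expR_ge0.
- exact/measurable_EFinP.
rewrite !(integral_past_step mS0 W_bm S0_W h_gt0 _ (aY _) (Y0 _)).
have -> : (-1 * al) ^+ 2 = (1 * al) ^+ 2 by ring.
rewrite -ge0_muleDl; last 2 first.
- by apply: integral_ge0 => w _; rewrite lee_fin.
- by apply: integral_ge0 => w _; rewrite lee_fin.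
rewrite -ge0_integralD//; last 4 first.
- by move=> w _; rewrite lee_fin.
- exact/measurable_EFinP.
- by move=> w _; rewrite lee_fin.
- exact/measurable_EFinP.
rewrite EFinM -AE /beta -expRN; congr (_ * (expR _)%:E)%E; last by ring.
apply: eq_integral => w _; rewrite -EFinD; congr EFin.
rewrite /Y /CC /cosh mul1r mulN1r mulNr.
by ring.
Qed.

(** [A k] is the mass of the martingale surviving at step k, [G k] its mass
    before the k-th sample is tested, and [q k] the probability of escaping at
    step k.  Hence [G k - A k] is the mass stopped at step k, which is compared
    with [q k]. *)
Let G k : R := if k is j.+1 then A j * beta^-1 else \int[P]_w CC (S0 w).

Let GE k : (\int[P]_w (CC (S k w) * inside k w)%:E = (G k)%:E)%E.
Proof.
case: k => [|k]; last exact: martingale.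
rewrite /= -(@ge0_Rintegral_fineK _ _ _ P _ cu)//.
- by apply: eq_integral => w _; rewrite sample0// /inside big_ord0 mulr1.
- exact: (measurableT_comp mCC).
- move=> w; rewrite CC_ge0 CC_le//.
  by have /andP[S00 S01] := S0_in w; rewrite !ltW.
Qed.

Let q k : R := \int[P]_w escape k w.

Let qE k : (\int[P]_w (escape k w)%:E = (q k)%:E)%E.
Proof.
apply: (@ge0_Rintegral_fineK _ _ _ P _ 1) => // w.
by case: (escape01 k w) => [->|[-> _]]; rewrite ?lexx ?ler01.
Qed.

Let escapeE k : (\int[P]_w (CC (S k w) * escape k w)%:E = (G k - A k)%:E)%E.
Proof.
have mCe : measurable_fun setT (fun w => CC (S k w) * escape k w).
  exact: measurable_funM.
have mCi : measurable_fun setT (fun w => CC (S k w) * inside k.+1 w).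
  exact: measurable_funM.
have := GE k; rewrite (eq_integral (fun w => (CC (S k w) * inside k.+1 w)%:E +
    (CC (S k w) * escape k w)%:E)%E); last first.
  by move=> w _; rewrite -EFinD insideS /escape; congr EFin; ring.
rewrite ge0_integralD//; last 4 first.
- by move=> w _; rewrite lee_fin mulr_ge0.
- exact/measurable_EFinP.
- by move=> w _; rewrite lee_fin mulr_ge0.
- exact/measurable_EFinP.
rewrite AE => GA; rewrite EFinB -GA.
by rewrite addeAC subee// add0e.
Qed.

Let escape_lower k : cl * q k <= G k - A k.
Proof.
rewrite -lee_fin EFinM -qE -escapeE -ge0_integralZl//; last 3 first.
- exact/measurable_EFinP.
- by move=> w _; rewrite lee_fin.
- by rewrite lee_fin cosh_ge0.
apply: ge0_le_integral => //.
- by move=> w _; rewrite mule_ge0// lee_fin ?cosh_ge0.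
- by apply: emeasurable_funM => //; exact/measurable_EFinP.
- by apply/measurable_EFinP; exact: measurable_funM.
move=> w _; rewrite -EFinM lee_fin.
case: (escape01 k w) => [->|[-> [_ SI]]]; first by rewrite !mulr0.
by rewrite !mulr1; exact: CC_ge.
Qed.

(** Before an escape the sample is in [del, 1 - del], so a step of size at most
    del ends in [0, 1], where the cosine is at most [cu].  For a larger step,
    e^(gam (|xi| - del)) >= 1 pays for the excess. *)
Let overshoot k w : CC (S k.+1 w) * escape k.+1 w <= cu * escape k.+1 w +
  expR (al / 2 - gam * del) *
    (expR ((al + gam) * xi k w) + expR (- (al + gam) * xi k w)).
Proof.
have [d0 d1] := (del_gt0, del_lt); have [al0 gam0] := (al_ge0, gam_ge0).
have e0 : 0 <= expR (al / 2 - gam * del) *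
    (expR ((al + gam) * xi k w) + expR (- (al + gam) * xi k w)).
  by rewrite mulr_ge0 ?addr_ge0 ?expR_ge0.
case: (escape01 k.+1 w) => [->|[-> [+ _]]]; first by rewrite !mulr0 add0r.
rewrite insideS => iS1.
have SI : del <= S k w <= 1 - del.
  by case: (inIP (S k w)) iS1 => -[-> //]; rewrite mulr0 => _ /esym/eqP;
    rewrite oner_eq0.
rewrite !mulr1; case: (lerP `|xi k w| del) => xid.
  rewrite -[leLHS]addr0 lerD//; apply: CC_le; rewrite sampleS.
  by move: xid; rewrite ler_norml; lra.
apply:
  (@le_trans _ _ (expR (al / 2 - gam * del) * expR ((al + gam) * `|xi k w|))).
  rewrite /CC (le_trans (cosh_le_expR _))// -expRD ler_expR normrM
    (ger0_norm al0).
  have : `|S k.+1 w - 1 / 2| <= 1 / 2 + `|xi k w|.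
    rewrite sampleS addrAC (le_trans (ler_normD _ _))// lerD2r ler_norml; lra.
  have : gam * del <= gam * `|xi k w| by rewrite ler_wpM2l// ltW.
  move: `|S k.+1 w - 1 / 2| `|xi k w| xid => x y xid gy xy.
  have : al * x <= al * (1 / 2 + y) by rewrite ler_wpM2l.
  rewrite mulrDl; rewrite mulrDr; lra.
rewrite -[leLHS]add0r lerD ?cosh_ge0// ler_wpM2l ?expR_ge0//.
by case: (ger0P (xi k w)) => _; rewrite ?mulNr ?mulrN;
  [rewrite lerDl|rewrite lerDr];
  rewrite expR_ge0.
Qed.

Let rho_ge0 : 0 <= rho.
Proof. by rewrite !mulr_ge0 ?expR_ge0. Qed.

Let escape_upper k : G k - A k <= cu * q k + rho.
Proof.
case: k => [|k].
  apply: (@le_trans _ _ (cu * q 0)); last by rewrite lerDl.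
  rewrite -lee_fin EFinM -qE -escapeE -ge0_integralZl//; last 3 first.
  - exact/measurable_EFinP.
  - by move=> w _; rewrite lee_fin.
  - by rewrite lee_fin cosh_ge0.
  apply: ge0_le_integral => //.
  - by move=> w _; rewrite lee_fin mulr_ge0.
  - by apply/measurable_EFinP; exact: measurable_funM.
  - by apply: emeasurable_funM => //; exact/measurable_EFinP.
  move=> w _; rewrite -EFinM lee_fin ler_wpM2r// CC_le// sample0//.
  by have /andP[S00 S01] := S0_in w; rewrite !ltW.
have mexp e : measurable_fun setT (fun w => expR (e * xi k w)).
  apply: measurableT_comp => //; apply: measurable_funM => //.
  exact: measurable_step.
have rhoE : (\int[P]_w (expR (al / 2 - gam * del) *
    (expR ((al + gam) * xi k w) + expR (- (al + gam) * xi k w)))%:E = rho%:E)%E.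
  under eq_integral do rewrite EFinM.
  rewrite ge0_integralZl//; last first.
    by apply/measurable_EFinP; exact: measurable_funD.
  under eq_integral do rewrite EFinD.
  rewrite ge0_integralD//; last 2 first.
  - exact/measurable_EFinP.
  - exact/measurable_EFinP.
  rewrite !(step_mgf W_bm h_gt0) sqrrN -EFinD -EFinM /rho; congr EFin; ring.
rewrite -lee_fin -escapeE EFinD EFinM -qE -rhoE -ge0_integralZl//; last 3 first.
- exact/measurable_EFinP.
- by move=> w _; rewrite lee_fin.
- by rewrite lee_fin cosh_ge0.
have me : measurable_fun setT (fun w => (expR (al / 2 - gam * del) *
    (expR ((al + gam) * xi k w) + expR (- (al + gam) * xi k w)))%:E).
  apply/measurable_EFinP; apply: measurable_funM => //.
  exact: measurable_funD.
rewrite -ge0_integralD//; last 2 first.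
- by move=> w _; rewrite mule_ge0// lee_fin ?cosh_ge0.
- by apply: emeasurable_funM => //; exact/measurable_EFinP.
apply: ge0_le_integral => //.
- by move=> w _; rewrite lee_fin mulr_ge0.
- by apply/measurable_EFinP; exact: measurable_funM.
- by apply: emeasurable_funD => //; apply: emeasurable_funM => //;
    exact/measurable_EFinP.
by move=> w _; rewrite -EFinM -EFinD lee_fin overshoot.
Qed.

(** This is e^(-s t) at the time t of the first escape, with s = al^2 / 2, and 0
    when none of the first K+1 samples escapes. *)
Definition discount K w : R := \sum_(k < K.+1) beta ^+ k * escape k w.

Let beta_gt0 : 0 < beta. Proof. exact: expR_gt0. Qed.

Let beta_le1 : beta <= 1.
Proof.
rewrite -expR0 ler_expR mulNr oppr_le0 mulr_ge0 ?(ltW h_gt0)//.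
by rewrite divr_ge0 ?sqr_ge0.
Qed.

Lemma measurable_discount K : measurable_fun setT (discount K).
Proof. by apply: measurable_sum => k; apply: measurable_funM. Qed.

(** The events of first escape at distinct steps are disjoint, so the sum has
    at most one nonzero term. *)
Lemma discountP K w :
  (discount K w = 0 /\ forall k, (k <= K)%N -> del <= S k w <= 1 - del) \/
  exists k, [/\ (k <= K)%N, discount K w = beta ^+ k,
    ~ (del <= S k w <= 1 - del) &
    forall j, (j < k)%N -> del <= S j w <= 1 - del].
Proof.
suff [[-> _ ?]|[k [? ? ? ?]]] : [/\ discount K w = 0, inside K.+1 w = 1 &
    forall k, (k <= K)%N -> del <= S k w <= 1 - del] \/
  exists k, [/\ (k <= K)%N, discount K w = beta ^+ k /\ inside K.+1 w = 0,
    ~ (del <= S k w <= 1 - del) &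
    forall j, (j < k)%N -> del <= S j w <= 1 - del]; first by left.
  by right; exists k; split => //; tauto.
elim: K => [|K [[d0 i1 SI]|[k [kK [dk i0] SI SIlt]]]].
- rewrite /discount big_ord_recr big_ord0 /= add0r expr0 mul1r insideS /escape.
  rewrite inside0 !mul1r.
  case: (inIP (S 0 w)) => -[-> SI]; [left|right].
    by rewrite subrr; split => // -[].
  by exists 0; rewrite subr0 expr0.
- rewrite /discount big_ord_recr /= -/(discount K w) d0 add0r
    insideS /escape i1.
  rewrite !mul1r; case: (inIP (S K.+1 w)) => -[-> SI']; [left|right].
    rewrite subrr mulr0; split=> // k;
      rewrite leq_eqVlt ltnS => /orP[/eqP->//|].
    exact: SI.
  by exists K.+1; rewrite subr0 mulr1; split.
- right; exists k; split => //; first exact: leqW.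
  rewrite /discount big_ord_recr /= -/(discount K w) insideS /escape i0.
  by rewrite !mul0r mulr0 addr0.
Qed.

Lemma discount_ge0_le1 K w : 0 <= discount K w <= 1.
Proof.
have [[-> _]|[k [_ -> _ _]]] := discountP K w; first by rewrite lexx ler01.
by rewrite exprn_ge0 ?exprn_ile1 ?beta_le1 ?(ltW beta_gt0).
Qed.

Let integral_discount K :
  \int[P]_w discount K w = \sum_(k < K.+1) beta ^+ k * q k.
Proof.
have iE k : P.-integrable setT (EFin \o escape k).
  apply: (@bounded_integrable _ _ _ P _ _ 1) => // w.
  by case: (escape01 k w) => [->|[-> _]]; rewrite ?normr0 ?normr1.
have iZ k : P.-integrable setT (EFin \o (fun w => beta ^+ k * escape k w)).
  apply: (@bounded_integrable _ _ _ P _ _ 1) => //;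
    first exact: measurable_funM.
  move=> w; have bk : 0 <= beta ^+ k <= 1.
    by rewrite exprn_ge0 ?exprn_ile1 ?beta_le1 ?(ltW beta_gt0).
  by case: (escape01 k w) => [->|[-> _]];
    rewrite ?mulr0 ?normr0// mulr1 ger0_norm; case/andP: bk.
rewrite /discount; elim: K => [|K IHK].
  rewrite big_ord_recr big_ord0 /= add0r -RintegralZl//.
  by apply: eq_Rintegral => w _; rewrite big_ord_recr big_ord0 /= add0r.
rewrite big_ord_recr /= -IHK -RintegralZl// -RintegralD//.
  by apply: eq_Rintegral => w _; rewrite big_ord_recr.
apply: (@bounded_integrable _ _ _ P _ _ 1) => //;
  first exact: measurable_discount.
by move=> w; have /andP[? ?] := discount_ge0_le1 K w; rewrite ger0_norm.
Qed.

(** Optional stopping at the first escape or at step K, whichever comes first: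
    the identity [beta G (k+1) = A k] makes the sum of the stopped masses
    telescope. *)
Let unroll K :
  cl * (\sum_(k < K.+1) beta ^+ k * q k) <= G 0 - beta ^+ K * A K
    <= cu * (\sum_(k < K.+1) beta ^+ k * q k) + K.+1%:R * rho.
Proof.
elim: K => [|K /andP[IHl IHu]].
  rewrite big_ord_recr big_ord0 /= add0r expr0 mulr1n !mul1r.
  by apply/andP; split; [exact: (escape_lower 0)|exact: (escape_upper 0)].
rewrite big_ord_recr -(natr1 K.+1) [X in _ + X]/=.
have /andP[b0 b1] : 0 <= beta ^+ K.+1 <= 1.
  by rewrite exprn_ge0 ?exprn_ile1 ?beta_le1 ?(ltW beta_gt0).
have l := ler_wpM2l b0 (escape_lower K.+1).
have u := ler_wpM2l b0 (escape_upper K.+1).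
have GA : beta ^+ K.+1 * (G K.+1 - A K.+1) =
  beta ^+ K * A K - beta ^+ K.+1 * A K.+1.
  by rewrite /= exprS; field; rewrite gt_eqF.
have r1 : beta ^+ K.+1 * rho <= rho by rewrite ler_piMl.
move: IHl IHu l u r1; rewrite GA.
move: (\sum_(_ < _) _) (q K.+1) (G 0) (beta ^+ K * A K)
  (beta ^+ K.+1 * A K.+1) => z y g x x'.
move: (beta ^+ K.+1) (K.+1%:R : R) cl cu rho => b' n c c' r.
rewrite (_ : c * (z + b' * y) = c * z + b' * (c * y)); last by ring.
rewrite (_ : c' * (z + b' * y) = c' * z + b' * (c' * y)); last by ring.
rewrite mulrDr mulrDl mul1r => IHl IHu l u r1.
by apply/andP; split; lra.
Qed.

(** The mass that survives step K is at most [cu], and beta^K [cu] once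
    discounted. *)
Lemma discount_bounds K :
  cl * (\int[P]_w discount K w) <= \int[P]_w CC (S0 w)
    <= cu * (\int[P]_w discount K w) + K.+1%:R * rho + beta ^+ K * cu.
Proof.
rewrite integral_discount; have /andP[l u] := unroll K.
have b0 : 0 <= beta ^+ K by rewrite exprn_ge0// ltW.
have := ler_wpM2l b0 (A_ge0 K); have := ler_wpM2l b0 (A_le K).
rewrite mulr0 => A1 A2.
apply/andP; split.
  by rewrite (le_trans l)// lerBlDr lerDl.
by rewrite -lerBlDr (le_trans _ u)// lerB.
Qed.

End SampledExit.

(** * Discounted hitting times of a continuous path *)

Section HittingFactor.
Context (R : realType).
Implicit Types (E : set R) (x : R -> R) (t v del : R).

(** The number e^(-T) for the infimum T of the nonnegative elements of E, which
    is 0 when there are none.  Working with e^(-T) avoids infinite times. *)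
Definition hit E : R :=
  sup ([set 0] `|` [set expR (- t) | t in [set t | 0 <= t /\ E t]]).

Let hit_set_ub E :
  ubound ([set 0] `|` [set expR (- t) | t in [set t | 0 <= t /\ E t]]) 1.
Proof.
by move=> _ [->|[t [t0 _] <-]]//; rewrite -expR0 ler_expR oppr_le0.
Qed.

Let hit_set_nonempty E :
  ([set 0] `|` [set expR (- t) | t in [set t | 0 <= t /\ E t]]) !=set0.
Proof. by exists 0; left. Qed.

Lemma hit_ge0 E : 0 <= hit E.
Proof. by apply: ub_le_sup; [exists 1; exact: hit_set_ub|left]. Qed.

Lemma hit_le1 E : hit E <= 1.
Proof. exact: ge_sup. Qed.

Lemma hit_ge E t : 0 <= t -> E t -> expR (- t) <= hit E.
Proof.
by move=> t0 Et; apply: ub_le_sup;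
  [exists 1; exact: hit_set_ub|right; exists t].
Qed.

Lemma hit_le E v : 0 <= v -> (forall t, 0 <= t -> E t -> expR (- t) <= v) ->
  hit E <= v.
Proof.
move=> v0 Ev; apply: ge_sup => // _ [->|[t [t0 Et] <-]]//.
exact: Ev.
Qed.

Lemma lt_hitP E v : 0 <= v ->
  v < hit E <-> exists t, [/\ 0 <= t, E t & v < expR (- t)].
Proof.
move=> v0; split=> [/sup_gt[|_ [->|[t [t0 Et] <-]] vt]//|[t [t0 Et vt]]].
- by move: vt; rewrite ltNge v0.
- by exists t.
- exact: lt_le_trans vt (hit_ge t0 Et).
Qed.

(** The times considered are positive, as in the definition of the first-exit
    time. *)
Definition exits x : set R := [set t | 0 < t /\ ~ (0 < x t < 1)].

Definition escapes del x : set R := [set t | ~ (del <= x t <= 1 - del)].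

Lemma path_continuousP x t e : {within `[0, +oo[, continuous x} ->
  0 <= t -> 0 < e -> exists2 eta, 0 < eta &
  forall u, 0 <= u -> `|u - t| < eta -> `|x u - x t| < e.
Proof.
move=> /subspace_continuousP xc t0 e0.
have /xc/cvgrPdist_lt/(_ e e0) : `[0, +oo[%classic t by rewrite /= in_itv/= t0.
rewrite /within /= => /nbhs_ballP[eta /= eta0 H]; exists eta => // u u0 ut.
rewrite distrC; apply: (H u); last by rewrite /= in_itv/= u0.
by rewrite /ball /= distrC.
Qed.

(** On a compact time interval a continuous path in an open interval stays away
    from its endpoints. *)
Lemma path_inside x a b : {within `[0, +oo[, continuous x} -> 0 <= a <= b ->
  (forall t, a <= t <= b -> 0 < x t < 1) ->
  exists2 del, 0 < del & forall t, a <= t <= b -> del <= x t <= 1 - del.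
Proof.
move=> xc /andP[a0 ab] xI.
have xab : {within `[a, b], continuous x}.
  apply: continuous_subspaceW xc => t /=;
    rewrite !in_itv/= andbT => /andP[at_ _].
  exact: le_trans a0 at_.
have [c cab xc_max] := EVT_max ab xab.
have [e eab xe_min] := EVT_min ab xab.
have /andP[_ xc1] : 0 < x c < 1 by apply: xI; move: cab; rewrite in_itv.
have /andP[xe0 _] : 0 < x e < 1 by apply: xI; move: eab; rewrite in_itv.
exists (Num.min (x e) (1 - x c)); first by rewrite lt_min xe0 subr_gt0.
move=> t tab; have tI : t \in `[a, b] by rewrite in_itv.
rewrite ge_min xe_min//= lerBrDr -lerBrDl ge_min; apply/orP; right.
by rewrite lerD2l lerN2 xc_max.
Qed.

(** The complement of a closed interval is open, so an escape lasts for a while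
    and is seen on a fine mesh. *)
Lemma escapes_open x del t : {within `[0, +oo[, continuous x} ->
  0 <= t -> escapes del x t ->
  exists2 eta, 0 < eta & forall u, t <= u -> u < t + eta -> escapes del x u.
Proof.
move=> xc t0 xt; case: (ltP (x t) del) => [xd|dx].
  have [|eta eta0 H] := path_continuousP (e := del - x t) xc t0.
    by rewrite subr_gt0.
  exists eta => // u tu ut /andP[du _].
  have := H u (le_trans t0 tu);
    rewrite ger0_norm ?subr_ge0// ltrBlDl => /(_ ut).
  by move=> /(le_lt_trans (ler_norm _)); rewrite ltrD2r ltNge du.
have dx1 : 1 - del < x t.
  by rewrite ltNge; apply/negP => xd; apply: xt; rewrite dx.
have [|eta eta0 H] := path_continuousP (e := x t - (1 - del)) xc t0.
  by rewrite subr_gt0.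
exists eta => // u tu ut /andP[_ ud].
have := H u (le_trans t0 tu); rewrite ger0_norm ?subr_ge0// ltrBlDl => /(_ ut).
rewrite distrC => /(le_lt_trans (ler_norm _)).
by rewrite ltrD2l ltrN2 ltNge ud.
Qed.

Lemma exits_escapes x del t : 0 < del -> exits x t -> escapes del x t.
Proof.
move=> d0 [t0 xt] /andP[dx xd]; apply: xt.
by rewrite (lt_le_trans d0 dx) (le_lt_trans xd)// ltrBlDr ltrDl.
Qed.

(** If the path did not leave (0, 1) up to time u, it stays in some
    [d, 1 - d] up to time u, so for small del it escapes [del, 1 - del] only
    after u. *)
Lemma cvg_hit_escapes x (del : R^nat) : {within `[0, +oo[, continuous x} ->
  0 < x 0 < 1 -> (forall n, 0 < del n) -> del n @[n --> \oo] --> 0 ->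
  hit (escapes (del n) x) @[n --> \oo] --> hit (exits x).
Proof.
move=> xc x0 del0 delc; apply/cvgrPdist_le => e e0.
have lower n : hit (exits x) <= hit (escapes (del n) x).
  apply: hit_le => [|t t0 xt]; first exact: hit_ge0.
  by apply: hit_ge => //; exact: exits_escapes.
have [big|small] := leP 1 (hit (exits x) + e).
  near=> n; rewrite distrC ger0_norm ?subr_ge0// lerBlDl.
  exact: le_trans (hit_le1 _) big.
(* An exit up to time u would be discounted to at least [hit (exits x) + e],
   which is impossible. *)
pose u := - ln (hit (exits x) + e).
have he0 : 0 < hit (exits x) + e by rewrite ltr_wpDl// hit_ge0.
have uE : expR (- u) = hit (exits x) + e by rewrite opprK lnK.
have u0 : 0 <= u by rewrite oppr_ge0 ln_le0// ltW.
have inside t : 0 <= t <= u -> 0 < x t < 1.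
  rewrite le_eqVlt => /andP[/orP[/eqP<-//|t0 tu]].
  apply: contrapT => xt; have := hit_ge (ltW t0) (conj t0 xt : exits x t).
  apply/negP; rewrite -ltNge (@lt_le_trans _ _ (expR (- u)))//.
    by rewrite uE ltrDl.
  by rewrite ler_expR lerN2.
have [d d0 xd] := path_inside xc (introT andP (conj (lexx 0) u0)) inside.
have [N _ delN] : \forall n \near \oo, del n <= d.
  by have /cvgrPdist_le/(_ d d0) := delc; apply: filterS => n;
    rewrite sub0r normrN => /(le_trans (ler_norm _)).
exists N => // n /= Nn; rewrite distrC ger0_norm ?subr_ge0// lerBlDl -uE.
apply: hit_le => [|t t0 xt]; first exact: expR_ge0.
rewrite ler_expR lerN2 leNgt; apply/negP => tu; apply: xt.
have /andP[dx xd'] := xd t (introT andP (conj t0 (ltW tu))).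
have dn := delN n Nn; rewrite (le_trans dn dx)/= (le_trans xd')//.
by rewrite lerD2l lerN2.
Unshelve. all: by end_near.
Qed.

End HittingFactor.

Lemma exists_invn_le (R : realType) (del : R) : 0 < del ->
  exists n : nat, n.+3%:R^-1 <= del.
Proof.
move=> d0; exists (Num.truncn del^-1); rewrite invf_ple ?posrE//.
have /andP[_ /ltW] :=
  @truncn_itv _ del^-1 (ltW (eq_ind_r is_true d0 (invr_gt0 del))).
by move=> /le_trans; apply; rewrite ler_nat;
  exact: leq_trans (leqnSn _) (leqnSn _).
Qed.

(** By continuity and compactness, an exit during [a, b] means that for every n
    some rational time of [a, b] finds the path outside [1/(n+3), 1 - 1/(n+3)].
    So the event that e^(-T) exceeds v is a countable combination of events about
    the path at rational times. *)
Lemma measurable_hit_exits d (T : measurableType d) (R : realType)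
    (X : R -> T -> R) : (forall t, 0 <= t -> measurable_fun setT (X t)) ->
  (forall w, {within `[0, +oo[, continuous (X^~ w)}) ->
  measurable_fun setT (fun w => hit (exits (X^~ w))).
Proof.
move=> mX cX mT; apply: (measurability _ (RGenOInfty.measurableE R)) => //.
move=> /= _ [_ [v ->] <-]; rewrite setTI.
have [v0|v0] := ltP v 0.
  rewrite [X in measurable X](_ : _ = setT)//; apply/seteqP; split => // w _ /=.
  by rewrite in_itv/= andbT (lt_le_trans v0) ?hit_ge0.
pose far n q := [set w | escapes (n.+3%:R^-1) (X^~ w) (ratr q)].
have mfar n q : 0 <= ratr q :> R -> measurable (far n q).
  move=> q0;
    rewrite [far n q](_ : _ =
    X (ratr q) @^-1` (~` `[n.+3%:R^-1, 1 - n.+3%:R^-1])).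
    by rewrite -[X in measurable X]setTI; apply: mX => //; apply: measurableC.
  by apply/seteqP; split => w; rewrite /far /escapes /= in_itv.
pose good (ab : rat * rat) :=
  [&& 0 < ratr ab.1 :> R, ratr ab.1 < ratr ab.2 :> R &
  v < expR (- ratr ab.2)].
pose inside (ab : rat * rat) q := (ratr ab.1 : R) <= (ratr q : R) <= ratr ab.2.
rewrite [X in measurable X](_ : _ = \bigcup_(ab in [set: rat * rat])
    (if good ab then \bigcap_n \bigcup_q (if inside ab q then far n q else set0)
     else set0)).
  apply: countable_bigcupT_measurable => [|ab]; first exact: countableP.
  case: ifPn => [/and3P[a0 ab12 _]|_]; last exact: measurable0.
  apply: bigcapT_measurable => n; apply: bigcupT_measurable_rat => q.
  case: ifPn => [/andP[aq _]|_]; last exact: measurable0.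
  by apply: mfar; exact: le_trans (ltW a0) aq.
apply/seteqP; split => w /=.
  rewrite in_itv/= andbT => /(lt_hitP _ v0)[t [t0 [t_gt0 xt] vt]].
  have [a] := rat_in_itvoo t_gt0; rewrite in_itv/= => /andP[a0 at_].
  (* When v = 0 there is no last admissible time - ln v; t + 1 replaces it. *)
  have tb : t < - ln (Num.max v (expR (- (t + 1)))).
    rewrite ltrNr -[X in _ < X]expRK ltr_ln ?posrE ?expR_gt0//.
      by rewrite gt_max vt /= ltr_expR ltrN2 ltrDl ltr01.
    by rewrite lt_max expR_gt0 orbT.
  have [b] := rat_in_itvoo tb; rewrite in_itv/= => /andP[tb' bv].
  have vb : v < expR (- ratr b).
    rewrite (@le_lt_trans _ _ (Num.max v (expR (- (t + 1)))))//.
      by rewrite le_max lexx.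
    have m0 : 0 < Num.max v (expR (- (t + 1))) by rewrite lt_max expR_gt0 orbT.
    by rewrite -(lnK (m0 : _ \is Num.pos)) ltr_expR ltrNr.
  exists (a, b) => //=; rewrite /good /= a0 vb (lt_trans at_ tb') /= => n _.
  have xt' : escapes (n.+3%:R^-1) (X^~ w) t by apply: exits_escapes => //.
  have [eta eta0 H] := escapes_open (cX w) t0 xt'.
  have tm : t < Num.min (t + eta) (ratr b) by rewrite lt_min ltrDl eta0.
  have [q] := rat_in_itvoo tm.
  rewrite in_itv/= lt_min => /and3P[tq qe qb]; exists q => //.
  rewrite /inside /= (ltW (lt_trans at_ tq)) (ltW qb) /=.
  by apply: H => //; exact: ltW.
move=> [[a b] _]; case: ifPn => // /and3P[/= a0 ab vb] H.
rewrite in_itv/= andbT; apply/(lt_hitP _ v0); apply: contrapT => noexit.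
have ab0 : 0 <= (ratr a : R) <= ratr b by rewrite !ltW.
have xI t : (ratr a : R) <= t <= ratr b -> 0 < X t w < 1.
  move=> /andP[at_ tb]; apply: contrapT => xt; apply: noexit; exists t.
  have t0 : 0 < t := lt_le_trans a0 at_.
  by split; [exact: ltW|split|rewrite (lt_le_trans vb)// ler_expR lerN2].
have [del del0 Hdel] := path_inside (cX w) ab0 xI.
have [n nd] := exists_invn_le del0.
have [q _] := H n I; case: ifPn => // /Hdel /andP[dx xd]; apply.
by rewrite (le_trans nd dx) (le_trans xd)// lerD2l lerN2.
Qed.

(** * Refining the mesh *)

Section Mesh.
Context (R : realType).

(** The meshes are 4^-m.  With 16^m steps, the time horizon 4^m tends to
    infinity. *)
Definition mesh (m : nat) : R := 4^-1 ^+ m.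

Lemma mesh_gt0 m : 0 < mesh m.
Proof. by rewrite exprn_gt0// invr_gt0. Qed.

Lemma mesh_horizon m : (16 ^ m)%N%:R * mesh m = 4 ^+ m.
Proof. by rewrite natrX -exprMn; congr (_ ^+ m); field. Qed.

Lemma cvg_mesh : mesh m @[m --> \oo] --> 0.
Proof. by apply: cvg_expr; rewrite ger0_norm ?invr_ge0// invf_lt1// ltr1n. Qed.

(** A power larger than x^4 = 16^m, where x = 2^m, is all that the overshoot
    estimate needs. *)
Lemma expR_lb5 (y : R) : 0 <= y -> (y / 5) ^+ 5 <= expR y.
Proof.
move=> y0; rewrite [in leRHS](_ : y = 5%:R * (y / 5)); last by field.
rewrite expRM_natl lerXn2r ?nnegrE ?expR_ge0 ?divr_ge0//.
by rewrite (le_trans _ (expR_ge1Dx _))// lerDr.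
Qed.

(** With mesh h = 4^-m and gam = 2^m = h^(-1/2), the Gaussian factor
    e^((c + gam)^2 h / 2) stays bounded, whereas e^(- gam del) beats the number
    16^m of steps. *)
Lemma cvg_overshoot (del c : R) : 0 < del -> 0 <= c ->
  (16 ^ m)%N.+1%:R * (2 * expR (c / 2 - 2 ^+ m * del) *
    expR ((c + 2 ^+ m) ^+ 2 * mesh m / 2)) @[m --> \oo] --> (0 : R).
Proof.
move=> d0 c0.
pose C : R := 4 * expR (c / 2 + (c + 1) ^+ 2 / 2) * (5 / del) ^+ 5.
apply: (@squeeze_cvgr _ _ _ _ (cst 0) (fun m => C * 2^-1 ^+ m)); last 2 first.
- exact: cvg_cst.
- rewrite -(mulr0 C); apply: cvgMl_tmp.
  by apply: cvg_expr; rewrite ger0_norm ?invr_ge0// invf_lt1// ltr1n.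
apply: nearW => m; apply/andP; split; first by rewrite !mulr_ge0 ?expR_ge0.
set x : R := 2 ^+ m; have x0 : 0 < x by rewrite exprn_gt0.
have x1 : 1 <= x by rewrite exprn_ege1 ?ler1n.
have meshE : mesh m = x ^- 2.
  have four : 4 = 2 ^+ 2 :> R by ring.
  by rewrite /mesh /x four exprVn -!exprM mulnC.
have KE : (16 ^ m)%N.+1%:R <= 2 * x ^+ 4.
  have -> : x ^+ 4 = (16 ^ m)%N%:R by rewrite natrX /x -exprM mulnC exprM;
    congr (_ ^+ m); ring.
  by rewrite -natrM ler_nat mul2n -addnn -addn1 leq_add2l expn_gt0.
(* Here (c + x)^2 h = (c / x + 1)^2 with x >= 1. *)
have e1 : expR ((c + x) ^+ 2 * mesh m / 2) <= expR ((c + 1) ^+ 2 / 2).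
  rewrite ler_expR ler_pM2r// meshE -exprVn -exprMn lerXn2r ?nnegrE//.
  - by rewrite mulr_ge0 ?addr_ge0 ?invr_ge0// ltW.
  - by rewrite addr_ge0.
  rewrite mulrDl divff ?gt_eqF// lerD2r ler_piMr// invf_le1//.
have e2 : expR (- (x * del)) <= (5 / del) ^+ 5 * x ^- 5.
  rewrite expRN invf_ple ?posrE ?expR_gt0//; last first.
    by rewrite mulr_gt0 ?exprn_gt0 ?divr_gt0// invr_gt0 exprn_gt0.
  apply: le_trans (expR_lb5 (mulr_ge0 (ltW x0) (ltW d0))).
  rewrite le_eqVlt; apply/orP; left; apply/eqP; field.
  by rewrite !gt_eqF.
rewrite expRD /C expRD (_ : 2^-1 ^+ m = x ^+ 4 * x ^- 5); last first.
  by rewrite exprVn -/x; field; rewrite gt_eqF.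
rewrite (_ : _ * _ = (16 ^ m)%N.+1%:R * (2 * expR (c / 2)) *
   (expR (- (x * del)) * expR ((c + x) ^+ 2 * mesh m / 2))); last by ring.
rewrite (_ : 4 * _ * _ * _ = 2 * x ^+ 4 * (2 * expR (c / 2)) *
   ((5 / del) ^+ 5 * x ^- 5 * expR ((c + 1) ^+ 2 / 2))); last by ring.
rewrite ler_pM ?mulr_ge0 ?expR_ge0//.
- by rewrite ler_wpM2r// mulr_ge0 ?expR_ge0.
- by rewrite ler_pM ?expR_ge0.
Qed.

Lemma cvg_horizon (s c : R) : 0 < s ->
  expR (- s * mesh m) ^+ (16 ^ m) * c @[m --> \oo] --> (0 : R).
Proof.
move=> s0; rewrite -(mul0r c); apply: cvgMr_tmp.
apply: (@squeeze_cvgr _ _ _ _ (cst 0) (fun m => s^-1 * mesh m)); last 2 first.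
- exact: cvg_cst.
- by rewrite -(mulr0 s^-1); apply: cvgMl_tmp; exact: cvg_mesh.
apply: nearW => m; apply/andP; split; first by rewrite exprn_ge0 ?expR_ge0.
rewrite -expRM_natl mulrCA mesh_horizon mulNr expRN /mesh exprVn -invfM.
rewrite lef_pV2 ?posrE ?expR_gt0 ?mulr_gt0 ?exprn_gt0//.
by rewrite (le_trans _ (expR_ge1Dx _))// lerDr.
Qed.

End Mesh.

(** * The exit transform of Brownian motion *)

Lemma cvg_pow (R : realType) (u : R^nat) (l : R) n :
  u m @[m --> \oo] --> l -> u m ^+ n @[m --> \oo] --> l ^+ n.
Proof. by move=> ul; apply: (cvg_comp _ _ ul (@exprn_continuous R n l)). Qed.

Section ExitTransform.
Context d (T : measurableType d) (R : realType) (P : probability T R).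
Variables (S0 : T -> R) (W : R -> {RV P >-> R}).
Hypothesis mS0 : measurable_fun setT S0.
Hypothesis W_bm : standard_brownian_motion W.
Hypothesis S0_W : forall A E, measurable A ->
  sigma_process `[0, +oo[ (fun t => W t : T -> R) E ->
  P (S0 @^-1` A `&` E) = (P (S0 @^-1` A) * P E)%E.
Hypothesis S0_in : forall w, 0 < S0 w < 1.

Definition started_path (w : T) (t : R) : R := S0 w + W t w.

Lemma started_path_continuous w :
  {within `[0, +oo[, continuous (started_path w)}.
Proof.
move=> t; apply: continuousD; first exact: cst_continuous.
exact: (bm_continuous W_bm).
Qed.

Lemma sqr_sqrt2 : (Num.sqrt 2 : R) ^+ 2 / 2 = 1.
Proof. by rewrite sqr_sqrtr// divff. Qed.

(** Both sides are read off the same first escape; so the exit time can be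
    studied with s = 1, that is with al = sqrt 2. *)
Lemma discount_pow (h del al : R) (n K : nat) w : 0 < h -> (0 < n)%N ->
  al ^+ 2 / 2 = n%:R ->
  discount S0 W h del al K w = discount S0 W h del (Num.sqrt 2) K w ^+ n.
Proof.
move=> h0 n0 aln.
have [[-> H]|[k [kK -> Sk Slt]]] := discountP S0 W h del al K w;
  have [[-> H']|[k' [kK' -> Sk' Slt']]] :=
    discountP S0 W h del (Num.sqrt 2) K w.
- by rewrite expr0n gtn_eqF.
- by exfalso; apply: Sk'; exact: H.
- by exfalso; apply: Sk; exact: H'.
- have <- : k = k'.
    have [kk'|kk'|//] := ltngtP k k'.
      by exfalso; apply: Sk; exact: Slt'.
    by exfalso; apply: Sk'; exact: Slt.
  rewrite aln sqr_sqrt2 -exprM mulnC exprM; congr (_ ^+ k).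
  by rewrite -expRM_natl; congr expR; ring.
Qed.

Lemma discount_le_hit (h del : R) K w : 0 < h ->
  discount S0 W h del (Num.sqrt 2) K w <= hit (escapes del (started_path w)).
Proof.
move=> h0; have [[-> _]|[k [_ -> Sk _]]] :=
  discountP S0 W h del (Num.sqrt 2) K w.
  exact: hit_ge0.
rewrite sqr_sqrt2 -expRM_natl mulN1r mulrN; apply: hit_ge => //.
by rewrite mulr_ge0// ltW.
Qed.

(** An escape of the sampled path is an escape of the path, so the limit is an
    upper bound.  Conversely an escape at t lasts up to some c > t, and once the
    mesh is finer than c - t there is a sample time in (t, c). *)
Lemma cvg_discount_hit (del : R) w :
  discount S0 W (mesh R m) del (Num.sqrt 2) (16 ^ m) w @[m --> \oo] -->
  hit (escapes del (started_path w)).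
Proof.
set V := hit _; apply/cvgrPdist_le => e e0.
have upper m := discount_le_hit del (16 ^ m) w (mesh_gt0 R m).
have [Ve|eV] := leP V e.
  apply: nearW => m; rewrite ger0_norm ?subr_ge0//.
  rewrite (le_trans _ Ve)// lerBlDr lerDl.
  by have /andP[] :=
    discount_ge0_le1 S0 W (mesh_gt0 R m) del (Num.sqrt 2) (16 ^ m) w.
have v0 : 0 < V - e by rewrite subr_gt0.
have [t [t0 xt vt]] : exists t, [/\ 0 <= t, escapes del (started_path w) t &
    V - e < expR (- t)].
  by apply/(lt_hitP _ (ltW v0)); rewrite ltrBlDr ltrDl.
have [eta eta0 xeta] := escapes_open (@started_path_continuous w) t0 xt.
(* Up to time b the discount is at least V - e; it is enough to find an
   escape of the sampled path before b. *)
pose b := - ln (V - e).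
have bE : expR (- b) = V - e by rewrite opprK lnK.
have tb : t < b by rewrite -ltrN2 -ltr_expR bE.
pose c := Num.min (t + eta) b.
have ct : 0 < c - t by rewrite subr_gt0 lt_min ltrDl eta0.
have mesh_small : \forall m \near \oo, mesh R m < c - t.
  by move: (@cvg_mesh R) => /cvgr_lt; apply.
have horizon_big : \forall m \near \oo, b <= m%:R by exact: nbhs_infty_ger.
apply: filterS2 mesh_small horizon_big => m hm bm.
have h0 := mesh_gt0 R m; rewrite ger0_norm ?subr_ge0// lerBlDl -lerBlDr.
(* The first sample time after t. *)
pose k := (Num.truncn (t / mesh R m)).+1.
have th0 : 0 <= t / mesh R m by rewrite divr_ge0// ltW.
have /andP[kl ku] := truncn_itv th0.
have tk : t < k%:R * mesh R m by rewrite -ltr_pdivrMr.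
have kc : k%:R * mesh R m < c.
  rewrite -natr1 mulrDl mul1r -ltrBrDr.
  rewrite (le_lt_trans (_ : _ <= t))//; first by rewrite -ler_pdivlMr.
  by rewrite ltrBrDr -ltrBrDl.
have kK : (k <= 16 ^ m)%N.
  rewrite -(ler_nat R) -(ler_pM2r h0) mesh_horizon.
  rewrite (le_trans (ltW kc))// ge_min; apply/orP; right.
  rewrite (le_trans bm)// -natrX ler_nat ltnW// ltn_expl//.
have escape_k : escapes del (started_path w) (k%:R * mesh R m).
  apply: xeta; first exact: ltW.
  by rewrite (lt_le_trans kc)// ge_min lexx.
have [[_ H]|[j [jK -> _ Slt]]] :=
  discountP S0 W (mesh R m) del (Num.sqrt 2) (16 ^ m) w.
  by exfalso; apply: escape_k; exact: (H k kK).
have jk : (j <= k)%N.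
  by rewrite leqNgt; apply/negP => kj; apply: escape_k; exact: Slt.
rewrite -bE sqr_sqrt2 -expRM_natl mulN1r mulrN ler_expR lerN2.
apply: (@le_trans _ _ (k%:R * mesh R m));
  first by rewrite ler_wpM2r ?ler_nat// ltW.
by rewrite (le_trans (ltW kc))// ge_min lexx orbT.
Qed.

Lemma measurable_hit_escapes del :
  measurable_fun setT (fun w => hit (escapes del (started_path w))).
Proof.
apply:
  (measurable_fun_cvg
  (h := fun m w => discount S0 W (mesh R m) del (Num.sqrt 2) (16 ^ m) w)).
  by move=> m; exact: measurable_discount.
by move=> w _; exact: cvg_discount_hit.
Qed.

(** For a fixed del the bounds pinch as the mesh is refined, up to the ratio of
    cosh(al/2) to cosh(al(1/2 - del)), which tends to 1 with del. *)
Lemma hit_exits_transform (n : nat) (al : R) : (0 < n)%N -> 0 <= al ->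
  al ^+ 2 / 2 = n%:R ->
  cosh (al / 2) * \int[P]_w (hit (exits (started_path w)) ^+ n) =
  \int[P]_w cosh (al * (S0 w - 1 / 2)).
Proof.
move=> n0 al0 aln.
set EC := RHS.
have mhit_exits : measurable_fun setT (fun w => hit (exits (started_path w))).
  apply: measurable_hit_exits => [t t0|w].
    exact: measurable_funD.
  exact: started_path_continuous.
have pow01 (E : set R) : `|hit E ^+ n| <= 1.
  by rewrite ger0_norm ?exprn_ge0 ?hit_ge0// exprn_ile1 ?hit_ge0 ?hit_le1.
have fixed_del del : 0 < del -> 2 * del < 1 ->
    cosh (al * (1 / 2 - del)) * \int[P]_w
      (hit (escapes del (started_path w)) ^+ n)
      <= EC
      <= cosh (al / 2) * \int[P]_w (hit (escapes del (started_path w)) ^+ n).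
  move=> d0 d1.
  pose Z m w := discount S0 W (mesh R m) del al (16 ^ m) w.
  have Zcvg : \int[P]_w Z m w @[m --> \oo] -->
      \int[P]_w (hit (escapes del (started_path w)) ^+ n).
    apply: (@cvg_Rintegral_bounded _ _ _ P _ _ 1).
    - by move=> m; apply: measurable_discount.
    - by apply: measurable_funX; exact: measurable_hit_escapes.
    - move=> m w; have /andP[? ?] :=
        discount_ge0_le1 S0 W (mesh_gt0 R m) del al (16 ^ m) w.
      by rewrite ger0_norm.
    - move=> w;
        under eq_fun do rewrite /Z (discount_pow _ _ _ (mesh_gt0 R _) n0 aln).
      by apply: cvg_pow; exact: cvg_discount_hit.
  have bounds m := discount_bounds mS0 W_bm S0_W (mesh_gt0 R m) S0_in d0 d1 al0
    (ltW (exprn_gt0 m (ltr0n R 2))) (16 ^ m).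
  apply/andP; split.
    apply: (cvgr_to_le (cvgMl_tmp (a := cosh (al * (1 / 2 - del))) Zcvg)).
    by apply: nearW => m; have /andP[] := bounds m.
  have s0 : 0 < al ^+ 2 / 2 by rewrite aln ltr0n.
  have errcvg : cosh (al / 2) * \int[P]_w Z m w +
      (16 ^ m)%N.+1%:R * (2 * expR (al / 2 - 2 ^+ m * del) *
        expR ((al + 2 ^+ m) ^+ 2 * mesh R m / 2)) +
      expR (- (al ^+ 2 / 2) * mesh R m) ^+ (16 ^ m) * cosh (al / 2)
        @[m --> \oo] -->
      cosh (al / 2) * \int[P]_w (hit (escapes del (started_path w)) ^+ n)
        + 0 + 0.
    apply: cvgD; last exact: cvg_horizon.
    by apply: cvgD; [exact: cvgMl_tmp|exact: cvg_overshoot].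
  rewrite -[leRHS]addr0 -[leRHS]addr0.
  apply: (cvgr_to_ge errcvg); apply: nearW => m.
  by have /andP[_] := bounds m.
pose del (j : nat) : R := j.+3%:R^-1.
have del0 j : 0 < del j by rewrite invr_gt0.
have del1 j : 2 * del j < 1.
  by rewrite -ltr_pdivlMr ?invr_gt0// invrK mul1r ltr_nat.
have delc : del j @[j --> \oo] --> 0.
  apply: (@squeeze_cvgr _ _ _ _ (cst 0) (fun j => j.+1%:R^-1)).
  - by apply: nearW => j; rewrite ltW//= lef_pV2 ?posrE// ler_nat !ltnS leqW.
  - exact: cvg_cst.
  - exact: cvg_harmonic.
have Vcvg : \int[P]_w (hit (escapes (del j) (started_path w)) ^+ n)
  @[j --> \oo] -->
    \int[P]_w (hit (exits (started_path w)) ^+ n).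
  apply: (@cvg_Rintegral_bounded _ _ _ P _ _ 1) => //.
  - by move=> j; apply: measurable_funX; exact: measurable_hit_escapes.
  - exact: measurable_funX.
  - move=> w; apply: cvg_pow; apply: cvg_hit_escapes => //.
      exact: (@started_path_continuous w).
    by rewrite /started_path (bm_start W_bm) addr0.
have clcvg : cosh (al * (1 / 2 - del j)) @[j --> \oo] --> cosh (al / 2).
  have inner : al * (1 / 2 - del j) @[j --> \oo] --> al / 2.
    rewrite [X in _ --> X](_ : _ = al * (1 / 2 - 0));
      last by rewrite subr0 mul1r.
    by apply: cvgMl_tmp; apply: cvgB => //; exact: cvg_cst.
  apply: cvgMr_tmp; apply: cvgD.
    exact: (cvg_comp _ _ inner (@continuous_expR R _)).
  exact: (cvg_comp _ _ (cvgN inner) (@continuous_expR R _)).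
apply/eqP; rewrite eq_le; apply/andP; split.
  apply: (cvgr_to_le (cvgM clcvg Vcvg)); apply: nearW => j.
  by have /andP[] := fixed_del _ (del0 j) (del1 j).
apply: (cvgr_to_ge (cvgMl_tmp (a := cosh (al / 2)) Vcvg)); apply: nearW => j.
by have /andP[] := fixed_del _ (del0 j) (del1 j).
Qed.

End ExitTransform.

(** * An exit racing against an exponential clock *)

Section ExponentialClock.
Context d (T : measurableType d) (R : realType) (P : probability T R).
Variables (V C : {mfun T >-> R}).
Hypothesis V01 : forall w, 0 <= V w <= 1.
Hypothesis C_gt0 : forall w, 0 < C w.
Hypothesis C_exp : forall A, measurable A -> P (C @^-1` A) =
  exponential_prob 1 A.
Hypothesis VC : forall A B, measurable A -> measurable B ->
    P (V @^-1` A `&` C @^-1` B) = (P (V @^-1` A) * P (C @^-1` B))%E.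

(** The factor e^(-C) of an exponential clock is uniform on (0, 1). *)
Lemma clock_survival (v : R) : 0 <= v <= 1 ->
  P [set w | expR (- C w) < v] = v%:E.
Proof.
move=> /andP[v0 v1]; have [v_gt0|] := ltP 0 v; last first.
  move=> v0'; have -> : v = 0 by apply/eqP; rewrite eq_le v0'.
  rewrite [X in P X](_ : _ = set0) ?measure0//.
  by apply/seteqP; split => // w /=; rewrite ltNge expR_ge0.
have [v_lt1|] := ltP v 1; last first.
  move=> v1'; have -> : v = 1 by apply/eqP; rewrite eq_le v1.
  rewrite [X in P X](_ : _ = setT) ?probability_setT//.
  by apply/seteqP; split => // w _ /=; rewrite -expR0 ltr_expR oppr_lt0.
have u0 : 0 < - ln v by rewrite oppr_gt0 ln_lt0// v_gt0.
rewrite [X in P X](_ : _ = ~` (C @^-1` `[0, - ln v])); last first.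
  apply/seteqP; split => w /=; rewrite in_itv/= (ltW (C_gt0 w))/=.
    by rewrite -[X in _ < X -> _]lnK ?posrE// ltr_expR ltrNl => /lt_geF ->.
  move=> /negP; rewrite -ltNge ltrNl -[X in _ -> _ < X]lnK ?posrE// ltr_expR//.
have mI : measurable (C @^-1` `[0, - ln v]).
  by rewrite -[X in measurable X]setTI; exact: measurable_funP.
rewrite probability_setC// C_exp// exponential_prob_itv0c//.
by rewrite mulN1r opprK lnK// -!EFinB opprB addrC subrK.
Qed.

Let indicator_lt :
  measurable_fun setT (fun z : R * R => ((expR (- z.2) < z.1)%R%:R : R)).
Proof.
apply: (measurableT_comp (f := fun b : bool => b%:R : R)) => //.
apply: measurable_fun_ltr => //.
by apply: measurableT_comp => //; apply: measurableT_comp.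
Qed.

(** Conditionally on V = v, the clock rings after the exit with probability v. *)
Lemma expectation_exit_before_clock (l : nat) :
  \int[P]_w (V w ^+ l * (expR (- C w) < V w)%R%:R) = \int[P]_w (V w ^+ l.+1).
Proof.
congr fine.
(* The absolute value makes the integrand nonnegative on the whole plane. *)
pose h (z : R * R) := ((`|z.1| ^+ l * (expR (- z.2) < z.1)%R%:R)%:E : \bar R).
have h0 z : (0 <= h z)%E by rewrite lee_fin mulr_ge0.
have mh : measurable_fun setT h.
  apply/measurable_EFinP; apply: measurable_funM => //.
  by apply: measurable_funX; apply: measurableT_comp.
transitivity (\int[P]_w h (V w, C w))%E.
  apply: eq_integral => w _; rewrite /h /= ger0_norm//.
  by have /andP[] := V01 w.
rewrite (ge0_integral_indep_pair VC mh h0).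
have mhv v : measurable_fun setT (fun c => h (v, c)).
  by apply: measurableT_comp => //; exact: pair1_measurable.
have inner v : (\int[distribution P C]_c h (v, c) =
    (`|v| ^+ l)%:E * P [set w | (expR (- C w) < v)%R])%E.
  rewrite (ge0_integral_distribution C (mhv v))//.
  have mE : measurable [set w | expR (- C w) < v].
    have mb : measurable_fun setT (fun w => expR (- C w) < v).
      apply: measurable_fun_ltr => //.
      by apply: measurableT_comp => //; apply: measurableT_comp.
    by have := mb measurableT [set true] I; rewrite setTI.
  transitivity
    (\int[P]_w ((`|v| ^+ l)%:E * (\1_[set w | (expR (- C w) < v)%R] w)%:E))%E.
    by apply: eq_integral => w _; rewrite /h /= indicE mem_setE /= EFinM.
  rewrite ge0_integralZl//.
  - by rewrite integral_indic// setIT.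
  - by apply/measurable_EFinP; exact: measurable_indic.
pose k (v : R) := (\int[distribution P C]_c h (v, c))%E.
have mk : measurable_fun setT k by exact: measurable_fun_fubini_tonelli_F.
have k0 v : (0 <= k v)%E by exact: integral_ge0.
rewrite -[LHS]/(\int[distribution P V]_v k v)%E.
rewrite ge0_integral_distribution//; apply: eq_integral => w _.
rewrite /= /k inner clock_survival// ger0_norm; last by have /andP[] := V01 w.
by rewrite exprSr.
Qed.

(** Conditionally on V = v, this is the integral of u^l over [v, 1], computed as
    the mass of [0, - ln v] under an exponential law of rate l + 1. *)
Lemma expectation_clock_before_exit (l : nat) :
  \int[P]_w (expR (- C w) ^+ l * (V w <= expR (- C w))%R%:R) =
  (1 - \int[P]_w (V w ^+ l.+1)) / l.+1%:R.
Proof.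
pose h (z : R * R) :=
  ((expR (- z.2) ^+ l * (z.1 <= expR (- z.2))%R%:R)%:E : \bar R).
have h0 z : (0 <= h z)%E by rewrite lee_fin mulr_ge0// exprn_ge0 ?expR_ge0.
have mh : measurable_fun setT h.
  apply/measurable_EFinP; apply: measurable_funM.
    apply: measurable_funX; apply: measurableT_comp => //.
    exact: measurableT_comp.
  apply: (measurableT_comp (f := fun b : bool => b%:R : R)) => //.
  apply: measurable_fun_ler => //.
  by apply: measurableT_comp => //; apply: measurableT_comp.
have mhv v : measurable_fun setT (fun c => h (v, c)).
  by apply: measurableT_comp => //; exact: pair1_measurable.
(* Discounting by e^(-l t) turns the rate 1 into the rate l + 1. *)
have pdfE (t : R) : ((expR (- t) ^+ l)%:E * (exponential_pdf 1 t)%:E =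
    (l.+1%:R^-1)%:E * (exponential_pdf l.+1%:R t)%:E)%E.
  rewrite -!EFinM; congr EFin; have [t0|t0] := leP 0 t; last first.
    by rewrite !lt0_exponential_pdf// !mulr0.
  rewrite !exponential_pdfE// mul1r mulKf ?pnatr_eq0//.
  rewrite -expRM_natl -expRD; congr expR; rewrite -natr1; ring.
have l0 : 0 < l.+1%:R :> R by [].
have mpow : measurable_fun setT (fun c : R => expR (- c) ^+ l).
  by apply: measurable_funX; exact: measurableT_comp.
have mpowE : measurable_fun setT (fun c : R => (expR (- c) ^+ l)%:E).
  exact/measurable_EFinP.
have pow0 (c : R) : (0 <= (expR (- c) ^+ l)%:E)%E.
  by rewrite lee_fin exprn_ge0 ?expR_ge0.
have mC : measurable_fun setT C by [].
have density (k : R -> \bar R) (mk : measurable_fun setT k)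
    (k0 : forall x, (0 <= k x)%E) :=
  ge0_integral_rv_density mC (measurable_exponential_pdf 1)
    (@exponential_pdf_ge0 _ 1 ler01) C_exp mk k0.
have inner v : 0 <= v <= 1 -> (\int[distribution P C]_c h (v, c) =
    ((1 - v ^+ l.+1) / l.+1%:R)%:E)%E.
  move=> /andP[v0 v1]; rewrite (ge0_integral_distribution C (mhv v))//.
  have [v1'|v_lt1] := leP 1 v.
    have -> : v = 1 by apply/eqP; rewrite eq_le v1.
    rewrite expr1n subrr mul0r integral0_eq// => w _; rewrite /h /=.
    by rewrite leNgt -[X in _ < X]expR0 ltr_expR oppr_lt0 C_gt0 mulr0.
  have [v_le0|v_gt0] := leP v 0.
    have vE : v = 0 by apply/eqP; rewrite eq_le v_le0.
    transitivity (\int[P]_w ((fun c => (expR (- c) ^+ l)%:E) (C w)))%E.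
      by apply: eq_integral => w _; rewrite /h /= vE expR_ge0 mulr1.
    rewrite (density _ mpowE pow0).
    under eq_integral do rewrite pdfE.
    rewrite ge0_integralZl//.
    - rewrite integral_exponential_pdf// mule1 vE expr0n/= subr0 mul1r//.
    - by apply/measurable_EFinP; exact: measurable_exponential_pdf.
    - by move=> x _; rewrite lee_fin exponential_pdf_ge0.
  have u0 : 0 < - ln v by rewrite oppr_gt0 ln_lt0// v_gt0.
  transitivity
    (\int[P]_w ((fun c => (expR (- c) ^+ l * \1_(`[0, - ln v]) c)%:E) (C w)))%E.
    apply: eq_integral => w _; rewrite /h /= indicE; congr (_ * _)%:E;
      congr (_%:R).
    rewrite mem_setE in_itv/= (ltW (C_gt0 w))/= -[X in X <= _]lnK ?posrE//.
    by rewrite ler_expR lerNr.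
  have mcut : measurable_fun setT
      (fun c : R => (expR (- c) ^+ l * \1_(`[0, - ln v]) c)%:E).
    by apply/measurable_EFinP; apply: measurable_funM;
      last exact: measurable_indic.
  have cut0 (c : R) : (0 <= (expR (- c) ^+ l * \1_(`[0, - ln v]) c)%:E)%E.
    by rewrite lee_fin mulr_ge0// exprn_ge0 ?expR_ge0.
  rewrite (density _ mcut cut0).
  transitivity (\int[lebesgue_measure]_(x in `[0%R, (- ln v)%R])
      ((l.+1%:R^-1)%:E * (exponential_pdf l.+1%:R x)%:E))%E.
    rewrite [RHS]integral_mkcond; apply: eq_integral => x _.
    rewrite patchE indicE; case: ifPn => _; last by rewrite mulr0 mul0e.
    by rewrite mulr1 pdfE.
  rewrite ge0_integralZl//.
  - rewrite -/(exponential_prob l.+1%:R `[0, - ln v]) exponential_prob_itv0c//.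
    rewrite -EFinB -EFinM mulrC mulNr mulrN opprK expRM_natl lnK//.
  - by apply/measurable_EFinP/measurable_funTS;
      exact: measurable_exponential_pdf.
  - by move=> x _; rewrite lee_fin exponential_pdf_ge0.
have mV : measurable_fun setT (fun w => V w ^+ l.+1) by exact: measurable_funX.
have V1 w : 0 <= V w ^+ l.+1 <= 1.
  by have /andP[v0 v1] := V01 w; rewrite exprn_ge0// exprn_ile1.
have iV : P.-integrable setT (EFin \o (fun w => V w ^+ l.+1)).
  apply: (@bounded_integrable _ _ _ P _ _ 1) => // w.
  by have /andP[? ?] := V1 w; rewrite ger0_norm.
have i1 : P.-integrable setT (EFin \o cst (1 : R)).
  by apply: (@bounded_integrable _ _ _ P _ _ 1) => // w; rewrite normr1.
transitivity (\int[P]_w ((1 - V w ^+ l.+1) / l.+1%:R)); last first.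
  rewrite RintegralZr//; last first.
    apply: (@bounded_integrable _ _ _ P _ _ 1) => //;
      first exact: measurable_funB.
    move=> w; have /andP[a b] := V1 w.
    by rewrite ger0_norm ?subr_ge0// lerBlDr lerDl.
  rewrite RintegralB// Rintegral_cst// mul1r.
  by rewrite (_ : fine (P setT) = 1)// probability_setT.
congr fine.
transitivity (\int[P]_w h (V w, C w))%E; first by apply: eq_integral.
rewrite (ge0_integral_indep_pair VC mh h0).
pose k (v : R) := (\int[distribution P C]_c h (v, c))%E.
have mk : measurable_fun setT k by exact: measurable_fun_fubini_tonelli_F.
have k0 v : (0 <= k v)%E by exact: integral_ge0.
rewrite -[LHS]/(\int[distribution P V]_v k v)%E.
rewrite ge0_integral_distribution//; apply: eq_integral => w _.
by rewrite /= /k inner.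
Qed.

End ExponentialClock.

(** * Cutting a path at its resetting times *)

Section ResettingPath.
Context (R : realType).
Variables (X : R -> R) (Y : nat -> R -> R) (ev : nat -> R).
Hypothesis ev0 : ev 0%N = 0.
Hypothesis evS : forall n, ev n < ev n.+1.
Hypothesis ev_unbounded : forall t, exists n, t < ev n.
Hypothesis XY : forall n t, ev n <= t < ev n.+1 -> X t = Y n (t - ev n).
Hypothesis Y_start : forall n, (0 < n)%N -> 0 < Y n 0 < 1.

(** The contribution of an exit in cycle n to the l-th power of the discounted
    exit time. *)
Definition cycle_term (U V : nat -> R) (l n : nat) : R :=
  (\prod_(k < n) (U k ^+ l * (V k <= U k)%R%:R)) *
    (V n ^+ l * (U n < V n)%R%:R).

Let V n := hit (exits (Y n)).
Let U n := expR (- (ev n.+1 - ev n)).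

Let prodU l n : (forall k, (k < n)%N -> V k <= U k) ->
  \prod_(k < n) (U k ^+ l * (V k <= U k)%R%:R) = expR (- ev n) ^+ l.
Proof.
elim: n => [_|n IHn VU]; first by rewrite big_ord0 ev0 oppr0 expR0 expr1n.
rewrite big_ord_recr /= IHn => [|k kn]; last by apply: VU; exact: leqW.
by rewrite VU// mulr1 -exprMn /U -expRD; congr (expR _ ^+ _); ring.
Qed.

Let ev_mono m n : (m <= n)%N -> ev m <= ev n.
Proof. by move: m n; apply/nondecreasing_seqP => n; exact: ltW. Qed.

Let cycle_of t : 0 <= t -> exists n, ev n <= t < ev n.+1.
Proof.
move=> t0; case: (ex_minnP (ev_unbounded t)) => -[|n] tn nmin.
  by move: tn; rewrite ev0 ltNge t0.
exists n; rewrite tn andbT leNgt; apply/negP => /nmin.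
by rewrite ltnn.
Qed.

Let exit_in_cycle n t : exits X t -> ev n <= t < ev n.+1 ->
  exits (Y n) (t - ev n).
Proof.
move=> [t0 Xt] nt; rewrite /exits /= -(XY nt); split => //.
have /andP[nt' _] := nt; rewrite subr_gt0 lt_neqAle nt' andbT.
apply/eqP => ntE; apply: Xt; rewrite (XY nt) ntE subrr Y_start// lt0n.
by apply/eqP => n0; move: t0; rewrite -ntE n0 ev0 ltxx.
Qed.

Let exit_from_cycle n u : exits (Y n) u -> u < ev n.+1 - ev n ->
  exits X (ev n + u).
Proof.
move=> [u0 Yu] un.
have ev_ge0 : 0 <= ev n by rewrite -ev0 ev_mono.
split; first by rewrite ltr_wpDl.
rewrite (XY (n := n)) ?lerDl ?(ltW u0)//= -?ltrBrDl//.
by rewrite addrAC subrr add0r.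
Qed.

(** At most one term of the sum is nonzero, the one of the first cycle in which
    the exit comes before the clock.  The path restarts inside the interval, so
    a resetting time is never an exit, and the two cases cover every path. *)
Lemma hit_exits_cycles : (hit (exits X) = 0 /\
    forall l N, \sum_(n < N) cycle_term U V l n = 0) \/
  exists n0, forall l N, \sum_(n < N) cycle_term U V l n =
    hit (exits X) ^+ l * (n0 < N)%N%:R.
Proof.
case: (pselect (exists n, U n < V n)) => [ex|noex]; [right|left]; last first.
  have VU n : V n <= U n by rewrite leNgt; apply/negP => UV; apply: noex;
    exists n.
  split; last first.
    by move=> l N; rewrite big1// => n _; rewrite /cycle_term ltNge VU/= !mulr0.
  apply/eqP; rewrite eq_le hit_ge0 andbT; apply: hit_le => // t t0 Xt.
  have [n nt] := cycle_of t0; have Yt := exit_in_cycle Xt nt.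
  have /andP[nt1 nt2] := nt.
  exfalso; have := le_trans (hit_ge (_ : 0 <= t - ev n) Yt) (VU n).
  rewrite subr_ge0 => /(_ nt1); rewrite ler_expR lerN2 leNgt.
  by rewrite ltrD2r nt2.
case: (ex_minnP ex) => n0 UV n0min; exists n0.
have VU k : (k < n0)%N -> V k <= U k.
  by rewrite leNgt => kn; apply/negP => /n0min; rewrite leqNgt kn.
have term_n0 l : cycle_term U V l n0 = (expR (- ev n0) * V n0) ^+ l.
  by rewrite /cycle_term prodU// UV mulr1 exprMn.
have term_other l n : n != n0 -> cycle_term U V l n = 0.
  rewrite /cycle_term => nn0; case: (ltngtP n n0) nn0 => // [nlt|ngt] _.
    by rewrite ltNge VU// !mulr0.
  rewrite (bigD1 (Ordinal ngt))//= leNgt UV/= mulr0 !mul0r//.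
have hitE : hit (exits X) = expR (- ev n0) * V n0.
  apply/eqP; rewrite eq_le; apply/andP; split.
    apply: hit_le => [|t t0 Xt]; first by rewrite mulr_ge0 ?expR_ge0 ?hit_ge0.
    have [n nt] := cycle_of t0; have Yt := exit_in_cycle Xt nt.
    have /andP[nt1 nt2] := nt; have tn0 : 0 <= t - ev n by rewrite subr_ge0.
    have n0n : (n0 <= n)%N.
      apply: n0min; apply: lt_le_trans (hit_ge tn0 Yt).
      by rewrite ltr_expR ltrN2 ltrD2r.
    have tE : expR (- t) = expR (- ev n) * expR (- (t - ev n)).
      by rewrite -expRD; congr expR; ring.
    move: n0n; rewrite leq_eqVlt => /orP[/eqP n0E|n0lt].
      by rewrite tE n0E ler_wpM2l ?expR_ge0// hit_ge.
    apply: (@le_trans _ _ (expR (- ev n0) * U n0)).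
      have -> : expR (- ev n0) * U n0 = expR (- ev n0.+1).
        by rewrite -expRD; congr expR; ring.
      by rewrite ler_expR lerN2 (le_trans (ev_mono n0lt) nt1).
    by rewrite ler_wpM2l ?expR_ge0// ltW.
  rewrite -ler_pdivlMl ?expR_gt0// leNgt; apply/negP => lt.
  pose v := Num.max (U n0) ((expR (- ev n0))^-1 * hit (exits X)).
  have v0 : 0 <= v by rewrite le_max expR_ge0.
  have [u [u0 Yu vu]] : exists u, [/\ 0 <= u, exits (Y n0) u & v < expR (- u)].
    by apply/(lt_hitP _ v0); rewrite gt_max UV lt.
  move: vu; rewrite gt_max ltr_expR ltrN2 => /andP[uT vu].
  have ev_ge0 : 0 <= ev n0 by rewrite -ev0 ev_mono.
  have := hit_ge (addr_ge0 ev_ge0 u0) (exit_from_cycle Yu uT).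
  rewrite opprD expRD -ler_pdivlMl ?expR_gt0// leNgt => /negP; exact.
move=> l N; case: (ltnP n0 N) => [nN|Nn]; last first.
  rewrite mulr0 big1// => n _; apply: term_other.
  by rewrite ltn_eqF// (leq_trans (ltn_ord n)).
rewrite mulr1 (bigD1 (Ordinal nN))//= term_n0 -hitE big1 ?addr0// => n nn0.
apply: term_other; apply: contra nn0 => /eqP nE; apply/eqP/val_inj.
by rewrite /= -nE.
Qed.

Lemma cvg_cycles l : (0 < l)%N ->
  \sum_(n < N) cycle_term U V l n @[N --> \oo] --> hit (exits X) ^+ l.
Proof.
move=> l0; have [[-> sum0]|[n0 sumE]] := hit_exits_cycles.
  by under eq_fun do rewrite sum0; rewrite expr0n gtn_eqF//; exact: cvg_cst.
apply: cvg_near_cst; exists n0.+1 => // N /= nN.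
by rewrite sumE nN mulr1.
Qed.

Lemma cycles_bound l N : 0 <= \sum_(n < N) cycle_term U V l n <= 1.
Proof.
have [[_ ->]|[n0 ->]] := hit_exits_cycles; first by rewrite lexx ler01.
rewrite mulr_ge0 ?exprn_ge0 ?hit_ge0//=.
by rewrite mulr_ile1 ?exprn_ge0 ?exprn_ile1 ?hit_ge0 ?hit_le1//;
  case: (_ < _)%N.
Qed.

End ResettingPath.

Section ExitTimeLaw.
Context (R : realType).

(** The infimum need not be attained, but t bounds it from above exactly when
    e^(-t) is bounded by the supremum. *)
Lemma first_exit_time_le d (T : measurableType d) (X : R -> T -> R) (w : T)
  (t : R) :
  (first_exit_time 1 X w <= t%:E)%E <-> expR (- t) <= hit (exits (X^~ w)).
Proof.
rewrite /first_exit_time; set E := [set _ | _ in _].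
split=> [inf_le|hit_ge_t].
  rewrite leNgt; apply/negP => lt.
  (* If the supremum were smaller than e^(-t), there would be no exit before
     - ln v > t; the maximum keeps v positive. *)
  pose v := Num.max (hit (exits (X^~ w))) (expR (- (t + 1))).
  have v0 : 0 < v by rewrite lt_max expR_gt0 orbT.
  have vt : v < expR (- t) by rewrite gt_max lt ltr_expR ltrN2 ltrDl ltr01.
  have : ((- ln v)%:E <= t%:E)%E.
    apply: le_trans inf_le; apply: le_ereal_inf_tmp => _ [s [s0 Xs] <-].
    rewrite lee_fin lerNl -ler_expR lnK// le_max; apply/orP; left.
    by apply: hit_ge; [exact: ltW|split].
  rewrite lee_fin lerNl -ler_expR lnK// leNgt vt//.
rewrite leNgt; apply/negP => lt.
have v0 : 0 <= expR (- t) by exact: expR_ge0.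
case inf_eq : (ereal_inf E) lt => [r| |]//.
- rewrite lte_fin => tr.
  have : hit (exits (X^~ w)) <= expR (- r).
    apply: hit_le => [|s s0 Xs]; first exact: expR_ge0.
    rewrite ler_expR lerN2 -lee_fin -inf_eq; apply: ereal_inf_lbound.
    by exists s.
  by rewrite leNgt (lt_le_trans _ hit_ge_t)// ltr_expR ltrN2.
- move=> _; have : hit (exits (X^~ w)) <= 0.
    apply: hit_le => // s s0 Xs.
    have : (ereal_inf E <= s%:E)%E by apply: ereal_inf_lbound; exists s.
    by rewrite inf_eq.
  by rewrite leNgt (lt_le_trans _ hit_ge_t)// expR_gt0.
Qed.

End ExitTimeLaw.

(** * Independence of the cycles *)

Section ProductExpectation.
Context d (T : measurableType d) (R : realType) (P : probability T R).

(** Induction on n: the product of the first n factors is a function of the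
    past. *)
Lemma indep_seq_expectation_prod (F : nat -> set (set T))
  (y : nat -> T -> R) n :
  indep_seq P F -> (forall i, F i `<=` measurable) ->
  (forall i, setI_closed (F i)) -> (forall i, F i setT) ->
  (forall i, adapted (F i) (y i)) -> (forall i w, 0 <= y i w <= 1) ->
  \int[P]_w (\prod_(k < n) y k w) = \prod_(k < n) \int[P]_w y k w.
Proof.
move=> Find Fm FI FT Fy y01.
have my i : measurable_fun setT (y i) by exact: adapted_measurable (Fy i).
have prod01 m w : 0 <= \prod_(k < m) y k w <= 1.
  apply/andP; split; first by apply: prodr_ge0 => k _; case/andP: (y01 k w).
  by apply: prodr_ile1 => k _; exact: y01.
have mprod m : measurable_fun setT (fun w => \prod_(k < m) y k w).
  by apply: measurable_prod => k _.
elim: n => [|n IHn].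
  rewrite big_ord0; under eq_Rintegral do rewrite big_ord0.
  by rewrite Rintegral_cst// mul1r (_ : fine (P setT) = 1)// probability_setT.
rewrite big_ord_recr /= -IHn.
apply: EFin_inj; rewrite EFinM.
rewrite -(ge0_Rintegral_fineK _ (mprod n.+1) (prod01 n.+1)).
rewrite -(ge0_Rintegral_fineK _ (mprod n) (prod01 n)).
rewrite -(ge0_Rintegral_fineK _ (my n) (y01 n)).
under eq_integral do rewrite big_ord_recr /=.
apply:
  (@ge0_integral_indepM _ _ _ P (mfun_of (mprod n)) (mfun_of (my n))) => /=.
- move=> A B mA mB; apply: (indep_past Find Fm FI);
    last exact: adapted_preimage.
  apply: adapted_preimage => //; apply: measurable_prod => k _.
  apply: sub_adapted (Fy k) => C FC; apply: sub_sigma_algebra.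
  exact: (cylinder_coord FT (ltn_ord k)).
- by move=> w; case/andP: (prod01 n w).
- by move=> w; case/andP: (y01 n w).
Qed.

End ProductExpectation.

Section Cycles.
Context d (T : measurableType d) (R : realType) (P : probability T R).
Variables (eta : {RV P >-> R}) (B : nat -> R -> {RV P >-> R})
  (ev : nat -> {RV P >-> R}) (X : R -> T -> R).
Hypothesis HX : brownian_resetting 1 (1 / 2) eta B ev X.

Definition clock n : {mfun T >-> R} :=
  mfun_of
    (measurable_funB (measurable_funP (ev n.+1)) (measurable_funP (ev n))).

Definition start n (w : T) : R := if n is 0 then eta w else 1 / 2.

Let sigma_B n := sigma_process `[0, +oo[ (fun t => B n t : T -> R).
Let sigma_start n (a : set T) := if n is 0 then sigma_rv eta a else a = setT.

(** Cycle n depends on its starting point, on its Brownian motion and on its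
    clock.  The starting point is random in cycle 0 only. *)
Definition cycle_events n : set (set T) := [set A | exists a e c,
  [/\ sigma_start n a, sigma_B n e, sigma_rv (clock n) c & A = a `&` e `&` c]].

Let sigma_startI n : setI_closed (sigma_start n).
Proof. by case: n => [|n];
  [exact: sigma_rvI|move=> _ _ -> ->; rewrite setIT]. Qed.

Let sigma_startT n : sigma_start n setT.
Proof. by case: n => [|n]//; exact: sigma_rvT. Qed.

Let sigma_BI n : setI_closed (sigma_B n).
Proof.
exact: (@measurableI _ (g_sigma_algebraType
  (\bigcup_(t in `[0, +oo[) sigma_rv (B n t : T -> R)))).
Qed.

Let sigma_BT n : sigma_B n setT.
Proof.
exact: (@measurableT _ (g_sigma_algebraType
  (\bigcup_(t in `[0, +oo[) sigma_rv (B n t : T -> R)))).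
Qed.

Let sigma_start_measurable n : sigma_start n `<=` measurable.
Proof.
by case: n => [|n];
  [exact: sigma_rv_measurable|move=> _ ->; exact: measurableT].
Qed.

Let sigma_B_measurable n : sigma_B n `<=` measurable.
Proof.
apply: sub_sigma_measurable => A [t _].
by apply: sigma_rv_measurable.
Qed.

Lemma cycle_eventsI n : setI_closed (cycle_events n).
Proof.
move=> _ _ [a [e [c [sa se sc ->]]]] [a' [e' [c' [sa' se' sc' ->]]]].
exists (a `&` a'), (e `&` e'), (c `&` c'); split.
- exact: sigma_startI.
- exact: sigma_BI.
- exact: sigma_rvI.
- by rewrite setIACA (setIACA a).
Qed.

Lemma cycle_eventsT n : cycle_events n setT.
Proof.
exists setT, setT, setT; split => //; last by rewrite !setIT.
exact: sigma_rvT.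
Qed.

Lemma cycle_events_measurable n : cycle_events n `<=` measurable.
Proof.
move=> _ [a [e [c [sa se sc ->]]]]; apply: measurableI;
  first apply: measurableI.
- exact: sigma_start_measurable sa.
- exact: sigma_B_measurable se.
- by apply: sigma_rv_measurable sc; exact: measurable_funP.
Qed.

Let sigma_ev := sigma_process setT (fun n => ev n : T -> R).

Let clock_ev n : sigma_rv (clock n) `<=` sigma_ev.
Proof.
have adev k : adapted (\bigcup_(n in setT) sigma_rv (ev n : T -> R)) (ev k).
  by apply: adapted_sub => A kA; apply: sub_sigma_algebra; exists k.
move=> _ [A mA <-]; rewrite setTI; apply: adapted_preimage => //.
exact: (measurable_funB (adev n.+1) (adev n)).
Qed.

(** The independence hypothesis concerns the starting point, the whole event
    process and each Brownian motion; the clocks are split afterwards by the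
    independence of the waiting times. *)
Let triples_prob n (a e c : nat -> set T) :
  (forall k, sigma_start k (a k)) -> (forall k, sigma_B k (e k)) ->
  (forall k, sigma_rv (clock k) (c k)) ->
  P (\big[setI/setT]_(k < n.+1) (a k `&` e k `&` c k)) =
  (P (a 0%N) * (\prod_(k < n.+1) P (c k)) * \prod_(k < n.+1) P (e k))%E.
Proof.
move=> sa se sc.
pose E i := match i with
  | 0 => a 0%N
  | 1 => \big[setI/setT]_(k < n.+1) c k
  | k.+2 => e k
  end.
have [J JE] : {J | J = index_iota 0 n.+1} by exists (index_iota 0 n.+1).
have uJ : uniq [:: 0, 1 & [seq k.+2 | k <- J]]%N.
  rewrite /= !inE /= map_inj_uniq; last by move=> i j [].
  rewrite {3}JE iota_uniq andbT.
  by apply/andP; split; apply/negP => /mapP[].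
have EJ i : i \in [:: 0, 1 & [seq k.+2 | k <- J]]%N -> match i with
    | 0 => sigma_rv eta
    | 1 => sigma_process setT (fun n => ev n : T -> R)
    | n.+2 => sigma_process `[0, +oo[ (fun t => B n t : T -> R)
    end (E i).
  rewrite !in_cons => /orP[/eqP->|/orP[/eqP->|/mapP[k _ ->]]].
  - exact: (sa 0%N).
  - apply: (@bigsetI_measurable _ (g_sigma_algebraType
      (\bigcup_(n in setT) sigma_rv (ev n : T -> R)))) => k _.
    exact: clock_ev (sc k).
  - exact: se.
have cP : P (\big[setI/setT]_(k < n.+1) c k) = (\prod_(k < n.+1) P (c k))%E.
  have := @pp_independent _ _ _ _ _ _ (reset_poisson HX) (index_iota 0 n.+1) c
    (iota_uniq _ _) (fun k _ => sc k).
  by rewrite bigcap_seq !big_mkord.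
have := reset_independent HX uJ EJ.
rewrite bigcap_seq !big_cons !big_map JE !big_mkord /= cP muleA => <-.
congr (P _); rewrite !big_split /= -setIA [X in _ `&` X]setIC; congr (_ `&` _).
rewrite big_ord_recl /= big1 ?setIT// => k _.
by have := sa (bump 0 k).
Qed.

Let triple_prob n a e c : sigma_start n a -> sigma_B n e ->
  sigma_rv (clock n) c -> P (a `&` e `&` c) = (P a * P e * P c)%E.
Proof.
move=> sa se sc.
pose at_ (A : set T) k := if k == n then A else setT.
have atE A : at_ A n = A by rewrite /at_ eqxx.
have atN A k : k != n -> at_ A k = setT by rewrite /at_ => /negPf->.
have big_at A : (\prod_(k < n.+1) P (at_ A k) = P A)%E.
  rewrite big_ord_recr /= atE big1 ?mul1e// => k _.
  by rewrite atN ?probability_setT// ltn_eqF.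
have := @triples_prob n (at_ a) (at_ e) (at_ c).
rewrite !big_at big_ord_recr /= !atE big1 ?setTI; last first.
  by move=> k _; rewrite !atN ?setIT// ltn_eqF.
move=> -> => [|k|k|k].
- have -> : P (at_ a 0%N) = P a.
    case: n @at_ atE {atN big_at} sa se sc => [|n] at_ atE sa _ _;
      first by rewrite atE.
    by rewrite sa /at_.
  by rewrite -!muleA; congr (_ * _)%E; rewrite muleC.
- by rewrite /at_; case: eqP => [->//|_]; exact: sigma_startT.
- by rewrite /at_; case: eqP => [->//|_]; exact: sigma_BT.
- by rewrite /at_; case: eqP => [->//|_]; exact: sigma_rvT.
Qed.

Lemma cycle_events_indep : indep_seq P cycle_events.
Proof.
move=> [|n] E FE; first by rewrite !big_ord0 probability_setT.
have [f fP] : {f : nat -> set T * set T * set T & forall k,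
    [/\ sigma_start k (f k).1.1, sigma_B k (f k).1.2,
      sigma_rv (clock k) (f k).2 &
     ((k < n.+1)%N -> E k = (f k).1.1 `&` (f k).1.2 `&` (f k).2)]}.
  apply: (@choice _ _ (fun k f => [/\ sigma_start k f.1.1, sigma_B k f.1.2,
    sigma_rv (clock k) f.2 & ((k < n.+1)%N -> E k =
      f.1.1 `&` f.1.2 `&` f.2)])) => k.
  case: (ltnP k n.+1) => [/FE[a [e [c [? ? ? ->]]]]|_];
    first by exists (a, e, c).
  exists (setT, setT, setT); split => //=; exact: sigma_rvT.
have sa k : sigma_start k (f k).1.1 by case: (fP k).
have se k : sigma_B k (f k).1.2 by case: (fP k).
have sc k : sigma_rv (clock k) (f k).2 by case: (fP k).
have EE (k : 'I_n.+1) : E k = (f k).1.1 `&` (f k).1.2 `&` (f k).2.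
  by case: (fP k) => _ _ _; apply.
rewrite (eq_bigr (fun k : 'I_n.+1 => (f k).1.1 `&` (f k).1.2 `&` (f k).2))//.
rewrite
  (@triples_prob n (fun k => (f k).1.1) (fun k => (f k).1.2)
  (fun k => (f k).2))//.
rewrite
  [RHS](eq_bigr (fun k : 'I_n.+1 => P (f k).1.1 * P (f k).1.2 * P (f k).2)%E);
  last first.
  by move=> k _; rewrite EE (triple_prob (sa k) (se k) (sc k)).
rewrite !big_split /= [in RHS]big_ord_recl /=
  (big1 _ _ (fun i : 'I_n => P (f (bump 0 i)).1.1)).
  by rewrite mule1 -!muleA; congr (_ * _)%E; rewrite muleC.
by move=> k _; have -> := sa (bump 0 k); rewrite probability_setT.
Qed.

Lemma start_path_indep n A e : measurable A -> sigma_B n e ->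
  P (start n @^-1` A `&` e) = (P (start n @^-1` A) * P e)%E.
Proof.
move=> mA se; case: n se => [|n] se.
  have := @triple_prob 0%N (eta @^-1` A) e setT _ se (sigma_rvT _).
  rewrite setIT probability_setT mule1; apply.
  by exists A; rewrite ?setTI.
have [A1|A1] := pselect (A (1 / 2)).
  by rewrite (_ : start n.+1 @^-1` A = setT) ?setTI ?probability_setT ?mul1e//;
    apply/seteqP; split.
rewrite (_ : start n.+1 @^-1` A = set0) ?set0I ?measure0 ?mul0e//.
by apply/seteqP; split.
Qed.

Lemma measurable_start n : measurable_fun setT (start n).
Proof. by case: n => [|n]; [exact: measurable_funP|exact: measurable_cst]. Qed.

Definition exit_factor n (w : T) : R :=
  hit (exits (started_path (start n) (B n) w)).

Let path_events n : set (set T) := [set A | exists a e,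
  [/\ sigma_start n a, sigma_B n e & A = a `&` e]].

Let path_events_adapted n : adapted (path_events n) (exit_factor n).
Proof.
apply: (@measurable_hit_exits _ (g_sigma_algebraType (path_events n)) _
  (fun t w => started_path (start n) (B n) w t)) => [t t0|w]; last first.
  exact: (@started_path_continuous _ _ _ _ (start n) _ (reset_brownian HX n) w).
apply: measurable_funD; last first.
  apply: adapted_sub => A sA; apply: sub_sigma_algebra.
  exists setT, A; split => //; last by rewrite setTI.
  by apply: sub_sigma_algebra; exists t => //=; rewrite in_itv/= t0.
case: n => [|n]; last exact: measurable_cst.
apply: adapted_sub => A sA; apply: sub_sigma_algebra.
by exists A, setT; split => //; rewrite setIT.
Qed.

Lemma exit_factor_adapted n : adapted (cycle_events n) (exit_factor n).
Proof.
apply: sub_adapted (@path_events_adapted n) => _ [a [e [sa se ->]]].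
apply: sub_sigma_algebra; exists a, e, setT; split => //; last by rewrite setIT.
exact: sigma_rvT.
Qed.

Lemma clock_adapted n : adapted (cycle_events n) (clock n).
Proof.
apply: adapted_sub => A sA; apply: sub_sigma_algebra.
by exists setT, setT, A; split => //; rewrite !setTI.
Qed.

Lemma measurable_exit_factor n : measurable_fun setT (exit_factor n).
Proof. exact: adapted_measurable (@cycle_events_measurable n)
  (@exit_factor_adapted n). Qed.

Lemma exit_factor_clock_indep n A C : measurable A -> measurable C ->
  P (exit_factor n @^-1` A `&` clock n @^-1` C) =
  (P (exit_factor n @^-1` A) * P (clock n @^-1` C))%E.
Proof.
move=> mA mC.
have sC : sigma_rv (clock n) (clock n @^-1` C) by exists C; rewrite ?setTI.
have mclock : measurable (clock n @^-1` C).
  by rewrite -[X in measurable X]setTI; exact: measurable_funP.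
apply: (indep_sigma mclock (G := path_events n)).
- move=> _ [a [e [sa se ->]]]; apply: measurableI.
    exact: sigma_start_measurable sa.
  exact: sigma_B_measurable se.
- move=> _ _ [a [e [sa se ->]]] [a' [e' [sa' se' ->]]].
  exists (a `&` a'), (e `&` e'); rewrite setIACA; split => //.
    exact: sigma_startI.
  exact: sigma_BI.
- move=> _ [a [e [sa se ->]]]; rewrite (triple_prob sa se sC); congr (_ * _)%E.
  have := triple_prob sa se (sigma_rvT (clock n)).
  by rewrite setIT probability_setT mule1 => ->.
- exact: adapted_preimage (@path_events_adapted n) _.
Qed.

Lemma clock_gt0 n w : 0 < clock n w.
Proof. by rewrite subr_gt0 (pp_increasing (reset_poisson HX)). Qed.

Lemma clock_exponential n A : measurable A ->
  P (clock n @^-1` A) = exponential_prob 1 A.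
Proof. exact: (pp_exponential (reset_poisson HX)). Qed.

Definition exit_moment (l n : nat) : R := \int[P]_w (exit_factor n w ^+ l).

Lemma exit_factor01 n w : 0 <= exit_factor n w <= 1.
Proof. by rewrite hit_ge0 hit_le1. Qed.

Let clock_factor n w : R := expR (- clock n w).

Let clock_factor01 n w : 0 <= clock_factor n w <= 1.
Proof. by rewrite expR_ge0 -[leRHS]expR0 ler_expR oppr_le0 ltW ?clock_gt0. Qed.

Lemma expectation_cycle_term (l n : nat) :
  \int[P]_w cycle_term (fun k => expR (- clock k w))
    (fun k => exit_factor k w) l n =
  (\prod_(k < n) ((1 - exit_moment l.+1 k) / l.+1%:R)) * exit_moment l.+1 n.
Proof.
(* The cycles before n contribute clock factors and cycle n an exit factor, so
   the term is one product of functions of successive cycles. *)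
pose y k w : R := if (k < n)%N
  then clock_factor k w ^+ l * (exit_factor k w <= clock_factor k w)%R%:R
  else exit_factor k w ^+ l * (clock_factor k w < exit_factor k w)%R%:R.
have y01 k w : 0 <= y k w <= 1.
  rewrite /y.
  have b01 (b : bool) (u : R) : 0 <= u <= 1 -> 0 <= u ^+ l * b%:R <= 1.
    move=> /andP[u0' u1']; case: b; rewrite ?mulr0 ?mulr1 ?lexx ?ler01//.
    by rewrite exprn_ge0// exprn_ile1.
  by case: ifP => _; apply: b01; [exact: clock_factor01|exact: exit_factor01].
have ay k : adapted (cycle_events k) (y k).
  have aV := @exit_factor_adapted k.
  have aU : adapted (cycle_events k) (clock_factor k).
    apply: measurableT_comp => //; apply: measurableT_comp => //.
    exact: (@clock_adapted k).
  rewrite /y; case: (k < n)%N;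
    (apply: measurable_funM; first exact: measurable_funX);
    apply: (measurableT_comp (f := fun b : bool => b%:R : R)) => //.
    exact: measurable_fun_ler.
  exact: measurable_fun_ltr.
have moment_before k := @expectation_exit_before_clock _ _ _ P
  (mfun_of (@measurable_exit_factor k)) (clock k) (exit_factor01 k)
  (clock_gt0 k) (@clock_exponential k) (@exit_factor_clock_indep k) l.
have moment_after k := @expectation_clock_before_exit _ _ _ P
  (mfun_of (@measurable_exit_factor k)) (clock k) (exit_factor01 k)
  (clock_gt0 k) (@clock_exponential k) (@exit_factor_clock_indep k) l.
transitivity (\int[P]_w \prod_(k < n.+1) y k w).
  apply: eq_Rintegral => w _; rewrite big_ord_recr /= /cycle_term /y ltnn.
  by congr (_ * _); apply: eq_bigr => k _; rewrite ltn_ord.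
rewrite (indep_seq_expectation_prod _ cycle_events_indep cycle_events_measurable
  cycle_eventsI cycle_eventsT ay y01).
rewrite big_ord_recr /=; congr (_ * _).
  apply: eq_bigr => k _; rewrite /y ltn_ord; exact: moment_after.
by rewrite /y ltnn; exact: moment_before.
Qed.

End Cycles.

(** * Polynomial approximation *)

Section Bernstein.
Context (R : realType).
Implicit Types (g : nat -> R) (y : R).

(** The Bernstein polynomial of g, as the expectation of g at a binomial variable
    with parameters n and 'X, by conditioning on the first trial. *)
Fixpoint bern n g : {poly R} :=
  if n is n'.+1 then 'X * bern n' (fun k => g k.+1) + (1 - 'X) * bern n' g
  else (g 0%N)%:P.

Lemma bernS n g y : (bern n.+1 g).[y] =
  y * (bern n (fun k => g k.+1)).[y] + (1 - y) * (bern n g).[y].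
Proof. by rewrite /= !hornerE. Qed.

Lemma bern_le n g g' y : 0 <= y <= 1 -> (forall k, g k <= g' k) ->
  (bern n g).[y] <= (bern n g').[y].
Proof.
move=> /andP[y0 y1]; elim: n g g' => [|n IHn] g g' gg';
  first by rewrite /= !hornerC.
rewrite !bernS lerD// ler_wpM2l ?subr_ge0// IHn//.
Qed.

(** The variance of the binomial law, in the form that survives induction. *)
Lemma bern_quadratic n (a b c y : R) :
  (bern n (fun k => a * (k%:R - c) ^+ 2 + b)).[y] =
  a * (n%:R * y * (1 - y) + (n%:R * y - c) ^+ 2) + b.
Proof.
elim: n c => [|n IHn] c; first by rewrite /= hornerC; ring.
rewrite bernS IHn -(natr1 n).
have -> : (fun k : nat => a * (k.+1%:R - c) ^+ 2 + b) =
    (fun k => a * (k%:R - (c - 1)) ^+ 2 + b).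
  by apply/funext => k; rewrite -natr1; ring.
by rewrite IHn; ring.
Qed.

(** Bernstein's proof: |phi (k/n) - phi y| is at most L |k/n - y|, and
    |z| <= dl + z^2 / dl turns this into a quadratic in k whose binomial
    expectation is known. *)
Lemma lipschitz_poly_approx (phi : R -> R) (L e : R) : 0 < L ->
  (forall x y, `|phi x - phi y| <= L * `|x - y|) -> 0 < e ->
  exists p : {poly R}, forall y, 0 <= y <= 1 -> `|p.[y] - phi y| <= e.
Proof.
move=> L0 phiL e0; pose dl := e / (2 * L).
have dl0 : 0 < dl by rewrite divr_gt0// mulr_gt0.
pose n := (Num.truncn (dl ^- 2)).+1.
have n0 : 0 < n%:R :> R by [].
have nE : dl ^- 2 <= n%:R.
  by rewrite ltW// truncnS_gt.
exists (bern n (fun k => phi (k%:R / n%:R))) => y y01.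
pose a := L / (dl * n%:R ^+ 2).
have close (k : nat) : `|phi (k%:R / n%:R) - phi y| <=
  a * (k%:R - n%:R * y) ^+ 2 + L * dl.
  apply: le_trans (phiL _ _) _;
    rewrite (_ : a * _ = L * ((k%:R / n%:R - y) ^+ 2 / dl)); last first.
    by rewrite /a; field; rewrite !gt_eqF.
  rewrite -mulrDr ler_wpM2l ?(ltW L0)// -(real_normK (num_real (_ - y))).
  move: `|_| (normr_ge0 (k%:R / n%:R - y)) => z z0.
  have [zd|dz] := leP z dl; first by rewrite ler_wpDl// divr_ge0 ?sqr_ge0// ltW.
  by rewrite ler_wpDr ?(ltW dl0)// ler_pdivlMr// expr2 ler_wpM2l// ltW.
have small : a * (n%:R * y * (1 - y)) + L * dl <= e.
  have y1 : y * (1 - y) <= 1 by case/andP: y01 => y0 y1; nra.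
  (* Half of the error is L dl; the other half is the variance term, at most
     L / (n dl), whence the choice of n >= 1 / dl^2. *)
  have -> : e = L * dl + L * dl by rewrite /dl; field; rewrite gt_eqF.
  rewrite lerD2r (_ : a * _ = L / (dl * n%:R) * (y * (1 - y))); last first.
    by rewrite /a; field; rewrite !gt_eqF.
  apply: (@le_trans _ _ (L / (dl * n%:R))).
    by rewrite ler_piMr// divr_ge0 ?(ltW L0)// mulr_ge0 ?(ltW dl0).
  rewrite ler_wpM2l ?(ltW L0)// invfM ler_pdivrMr//.
  by rewrite -ler_pdivrMl// -expr2 exprVn.
have bconst b : (bern n (fun k => a * (k%:R - n%:R * y) ^+ 2 + b)).[y] =
    a * (n%:R * y * (1 - y)) + b.
  by rewrite bern_quadratic subrr expr0n/= addr0.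
have bconstN b : (bern n (fun k => - a * (k%:R - n%:R * y) ^+ 2 + b)).[y] =
    - a * (n%:R * y * (1 - y)) + b.
  by rewrite bern_quadratic subrr expr0n/= addr0.
rewrite ler_distl; apply/andP; split.
  apply: (@le_trans _ _ (- a * (n%:R * y * (1 - y)) + (phi y - L * dl))).
    by rewrite mulNr; move: small; lra.
  rewrite -bconstN; apply: bern_le => // k.
  by have := close k; rewrite ler_norml mulNr => /andP[]; lra.
apply: (@le_trans _ _ (a * (n%:R * y * (1 - y)) + (phi y + L * dl))).
  rewrite -bconst; apply: bern_le => // k.
  by have := close k; rewrite ler_norml => /andP[]; lra.
by move: small; lra.
Qed.

(** A continuous approximation of the indicator of [c, +oo) from above. *)
Definition ramp (c : R) (N : nat) (y : R) : R :=
  Num.max 0 (Num.min 1 (1 + N.+1%:R * (y - c))).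

Lemma ramp01 c N y : 0 <= ramp c N y <= 1.
Proof. by rewrite /ramp le_max lexx ge_max ler01 ge_min lexx. Qed.

Lemma ramp_lipschitz c N x y : `|ramp c N x - ramp c N y| <= N.+1%:R * `|x - y|.
Proof.
have h (u v : R) : u <= v -> 0 <= ramp c N v - ramp c N u <= N.+1%:R * (v - u).
  move=> uv; have : N.+1%:R * (u - c) <= N.+1%:R * (v - c).
    by rewrite ler_wpM2l// lerD2r.
  have -> : N.+1%:R * (v - u) = N.+1%:R * (v - c) - N.+1%:R * (u - c) by ring.
  rewrite /ramp; move: (_ * _) (_ * _) => p q pq.
  rewrite !maxEle !minEle.
  by do 4! case: ifP => /idP; move=> *; apply/andP; split; lra.
have [xy|yx] := leP x y.
  rewrite distrC (distrC x); have /andP[a b] := h _ _ xy.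
  by rewrite !ger0_norm ?subr_ge0// -subr_ge0.
have /andP[a b] := h _ _ (ltW yx).
by rewrite !ger0_norm ?subr_ge0 ?(ltW yx)// -subr_ge0.
Qed.

Lemma cvg_ramp c y : ramp c N y @[N --> \oo] --> ((c <= y)%R%:R : R).
Proof.
have [cy|yc] := leP c y.
  under eq_fun => N.
    rewrite /ramp min_l ?max_r//; last first.
      by rewrite lerDl mulr_ge0// subr_ge0.
    over.
  exact: cvg_cst.
have d0 : 0 < c - y by rewrite subr_gt0.
apply: cvg_near_cst; exists (Num.truncn (c - y)^-1) => // N /= Nn.
have cN : (c - y)^-1 <= N.+1%:R.
  by rewrite (le_trans (ltW (truncnS_gt _)))// ler_nat.
have : 1 <= N.+1%:R * (c - y) by rewrite -ler_pdivrMr// mul1r.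
move=> H; rewrite /ramp max_l// ge_min; apply/orP; right.
by rewrite -(opprB c y) mulrN subr_le0.
Qed.

End Bernstein.

(** * The moment problem on the unit interval *)

Section WeightedMoments.
Context d (T : measurableType d) (R : realType).
Variables (m : {measure set T -> \bar R}) (A : set T) (D w : T -> R).
Hypothesis mA : measurable A.
Hypothesis mD : measurable_fun A D.
Hypothesis D01 : forall x, A x -> 0 <= D x <= 1.
Hypothesis w_ge0 : forall x, A x -> 0 <= w x.
Hypothesis iw : m.-integrable A (EFin \o w).

(** The integral of phi against the image by D of the measure with density w.
    The law of a random variable and the image of a density are both of this
    form. *)
Definition weighted (phi : R -> R) : R := \int[m]_(x in A) (phi (D x) * w x).

Let mw : measurable_fun A w.
Proof. exact/measurable_EFinP/(measurable_int m). Qed.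

Lemma weighted_integrable (phi : R -> R) M : measurable_fun setT phi ->
  (forall y, 0 <= y <= 1 -> `|phi y| <= M) ->
  m.-integrable A (EFin \o (fun x => phi (D x) * w x)).
Proof.
move=> mphi phiM; apply: (le_integrable mA _ _ (integrableZl mA M iw)).
- apply/measurable_EFinP; apply: measurable_funM => //.
  exact: measurableT_comp.
- move=> x Ax; rewrite /= lee_fin normrM (ger0_norm (w_ge0 Ax)).
  have M0 : 0 <= M := le_trans (normr_ge0 _) (phiM _ (D01 Ax)).
  rewrite (ger0_norm (mulr_ge0 M0 (w_ge0 Ax))).
  by rewrite ler_wpM2r ?w_ge0// phiM// D01.
Qed.

Lemma weightedD (phi psi : R -> R) M N : measurable_fun setT phi ->
  measurable_fun setT psi -> (forall y, 0 <= y <= 1 -> `|phi y| <= M) ->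
  (forall y, 0 <= y <= 1 -> `|psi y| <= N) ->
  weighted (fun y => phi y + psi y) = weighted phi + weighted psi.
Proof.
move=> mphi mpsi phiM psiN; rewrite /weighted -RintegralD//.
- by apply: eq_Rintegral => x _; rewrite mulrDl.
- exact: weighted_integrable phiM.
- exact: weighted_integrable psiN.
Qed.

Lemma weightedZ (c : R) (phi : R -> R) M : measurable_fun setT phi ->
  (forall y, 0 <= y <= 1 -> `|phi y| <= M) ->
  weighted (fun y => c * phi y) = c * weighted phi.
Proof.
move=> mphi phiM; rewrite /weighted -RintegralZl//.
- by apply: eq_Rintegral => x _; rewrite mulrA.
- exact: weighted_integrable phiM.
Qed.

Lemma weighted_close (phi psi : R -> R) M N e : measurable_fun setT phi ->
  measurable_fun setT psi -> (forall y, 0 <= y <= 1 -> `|phi y| <= M) ->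
  (forall y, 0 <= y <= 1 -> `|psi y| <= N) ->
  (forall y, 0 <= y <= 1 -> `|phi y - psi y| <= e) ->
  `|weighted phi - weighted psi| <= e * \int[m]_(x in A) w x.
Proof.
move=> mphi mpsi phiM psiN close.
have iphi := weighted_integrable mphi phiM.
have ipsi := weighted_integrable mpsi psiN.
have mdiff : measurable_fun setT (fun y => phi y - psi y) by
  exact: measurable_funB.
rewrite /weighted -RintegralB// -RintegralZl//.
under eq_Rintegral do rewrite -mulrBl.
have idiff := weighted_integrable mdiff close.
apply: le_trans (le_normr_Rintegral mA idiff) _.
apply: le_Rintegral => //.
- exact: integrable_norm idiff.
- exact: (integrableZl mA e iw).
- move=> x Ax; rewrite normrM (ger0_norm (w_ge0 Ax)).
  by rewrite ler_wpM2r ?w_ge0// close// D01.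
Qed.

Lemma cvg_weighted_ramp (c : R) :
  weighted (ramp c N) @[N --> \oo] --> weighted (fun y => (c <= y)%R%:R).
Proof.
have mramp N : measurable_fun setT (ramp c N).
  apply: measurable_maxr => //; apply: measurable_minr => //.
  by apply: measurable_funD => //; apply: measurable_funM => //;
    exact: measurable_funB.
have mind : measurable_fun setT (fun y : R => (c <= y)%R%:R : R).
  by apply: (measurableT_comp (f := fun b : bool => b%:R : R)) => //;
    exact: measurable_fun_ler.
have mwr (phi : R -> R) : measurable_fun setT phi ->
    measurable_fun A (fun x => (phi (D x) * w x)%:E).
  move=> mphi; apply/measurable_EFinP; apply: measurable_funM => //.
  exact: measurableT_comp.
have cvg_pt x : A x -> (ramp c N (D x) * w x)%:E @[N --> \oo] -->
    (((c <= D x)%R%:R * w x)%:E : \bar R).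
  by move=> _; apply: cvg_EFin;
    [exact: nearW|apply: cvgMr_tmp; exact: cvg_ramp].
have bound x N : A x -> (`|(ramp c N (D x) * w x)%:E| <= (w x)%:E)%E.
  move=> Ax; have /andP[r0 r1] := ramp01 c N (D x).
  rewrite lee_fin ger0_norm ?mulr_ge0 ?w_ge0//.
  by rewrite ler_piMl ?w_ge0.
have [ilim _ cvgI] :=
  dominated_convergence mA (fun N => mwr _ (mramp N)) (mwr _ mind)
  (aeW _ cvg_pt) iw (aeW _ bound).
by apply: fine_cvg; rewrite fineK//; exact: integrable_fin_num.
Qed.

End WeightedMoments.

Lemma horner_bounded (R : realType) (p : {poly R}) y : 0 <= y <= 1 ->
  `|p.[y]| <= \sum_(i < size p) `|p`_i|.
Proof.
move=> /andP[y0 y1]; rewrite horner_coef (le_trans (ler_norm_sum _ _ _))//.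
apply: ler_sum => i _; rewrite normrM ler_piMr// ger0_norm ?exprn_ge0//.
exact: exprn_ile1.
Qed.

Lemma measurable_horner (R : realType) (p : {poly R}) :
  measurable_fun setT (fun y => p.[y]).
Proof.
under eq_fun do rewrite horner_coef.
by apply: measurable_sum => i; apply: measurable_funM => //;
  exact: measurable_funX.
Qed.

Section MomentUniqueness.
Context d1 (T1 : measurableType d1) d2 (T2 : measurableType d2) (R : realType).
Variables (m1 : {measure set T1 -> \bar R}) (A1 : set T1) (D1 w1 : T1 -> R).
Variables (m2 : {measure set T2 -> \bar R}) (A2 : set T2) (D2 w2 : T2 -> R).
Hypotheses (mA1 : measurable A1) (mA2 : measurable A2).
Hypotheses (mD1 : measurable_fun A1 D1) (mD2 : measurable_fun A2 D2).
Hypotheses (D1_01 : forall x, A1 x -> 0 <= D1 x <= 1)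
  (D2_01 : forall x, A2 x -> 0 <= D2 x <= 1).
Hypotheses (w1_ge0 : forall x, A1 x -> 0 <= w1 x)
  (w2_ge0 : forall x, A2 x -> 0 <= w2 x).
Hypotheses (iw1 : m1.-integrable A1 (EFin \o w1))
  (iw2 : m2.-integrable A2 (EFin \o w2)).
Hypothesis moments : forall n : nat,
  \int[m1]_(x in A1) (D1 x ^+ n * w1 x) = \int[m2]_(x in A2) (D2 x ^+ n * w2 x).

Let E1 := weighted m1 A1 D1 w1.
Let E2 := weighted m2 A2 D2 w2.

Let monomial_le (n : nat) (y : R) : 0 <= y <= 1 -> `|y ^+ n| <= 1.
Proof. by move=> /andP[y0 y1]; rewrite ger0_norm ?exprn_ge0// exprn_ile1. Qed.

(** The extra monomial makes the induction on p go through. *)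
Let poly_moments (p : {poly R}) (n : nat) :
  E1 (fun y => y ^+ n * p.[y]) = E2 (fun y => y ^+ n * p.[y]).
Proof.
elim/poly_ind: p n => [|p c IHp] n.
  rewrite /E1 /E2 /weighted.
  under eq_Rintegral do rewrite horner0 mulr0 mul0r.
  under [RHS]eq_Rintegral do rewrite horner0 mulr0 mul0r.
  by rewrite !Rintegral_cst// !mul0r.
have -> : (fun y => y ^+ n * (p * 'X + c%:P).[y]) =
    (fun y => y ^+ n.+1 * p.[y] + c * y ^+ n).
  by apply/funext => y; rewrite !hornerE exprS; ring.
have mpow k : measurable_fun setT (fun y : R => y ^+ k) by
  exact: measurable_funX.
have mphi : measurable_fun setT (fun y : R => y ^+ n.+1 * p.[y]).
  by apply: measurable_funM => //; exact: measurable_horner.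
have mpsi : measurable_fun setT (fun y : R => c * y ^+ n) by
  exact: measurable_funM.
have phiM y : 0 <= y <= 1 -> `|y ^+ n.+1 * p.[y]| <=
  1 * \sum_(i < size p) `|p`_i|.
  by move=> y01; rewrite normrM ler_pM// ?monomial_le// horner_bounded.
have psiM y : 0 <= y <= 1 -> `|c * y ^+ n| <= `|c| * 1.
  by move=> y01; rewrite normrM ler_wpM2l// monomial_le.
rewrite /E1 /E2 (weightedD mA1 mD1 D1_01 w1_ge0 iw1 mphi mpsi phiM psiM).
rewrite (weightedD mA2 mD2 D2_01 w2_ge0 iw2 mphi mpsi phiM psiM).
rewrite (weightedZ mA1 mD1 D1_01 w1_ge0 iw1 _ (mpow n) (@monomial_le n)).
rewrite (weightedZ mA2 mD2 D2_01 w2_ge0 iw2 _ (mpow n) (@monomial_le n)).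
by congr (_ + _ * _); [exact: IHp|exact: moments].
Qed.

Let ramp_moments c N : E1 (ramp c N) = E2 (ramp c N).
Proof.
have mramp : measurable_fun setT (ramp c N).
  apply: measurable_maxr => //; apply: measurable_minr => //.
  by apply: measurable_funD => //; apply: measurable_funM => //;
    exact: measurable_funB.
have rampM y : 0 <= y <= 1 -> `|ramp c N y| <= 1.
  by move=> _; have /andP[r0 r1] := ramp01 c N y; rewrite ger0_norm.
(* An approximation within e / K costs at most e in the two integrals
   together; the extra 1 makes K positive. *)
pose K := \int[m1]_(x in A1) w1 x + \int[m2]_(x in A2) w2 x + 1.
have I1 : 0 <= \int[m1]_(x in A1) w1 x by exact: Rintegral_ge0.
have I2 : 0 <= \int[m2]_(x in A2) w2 x by exact: Rintegral_ge0.
have K0 : 0 < K by rewrite ltr_wpDl// addr_ge0.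
apply/eqP; rewrite -subr_eq0 -normr_eq0 eq_le normr_ge0 andbT.
apply/ler_addgt0Pr => e e0; rewrite add0r.
have [p pramp] := lipschitz_poly_approx (ltr0Sn R N) (@ramp_lipschitz R c N)
  (divr_gt0 e0 K0).
have mp := measurable_horner p.
have c1 := weighted_close mA1 mD1 D1_01 w1_ge0 iw1 mp mramp (horner_bounded p)
  rampM pramp.
have c2 := weighted_close mA2 mD2 D2_01 w2_ge0 iw2 mp mramp (horner_bounded p)
  rampM pramp.
have pE : E1 (fun y => p.[y]) = E2 (fun y => p.[y]).
  have := poly_moments p 0.
  rewrite (_ : (fun y => y ^+ 0 * p.[y]) = (fun y => p.[y]))//.
  by apply/funext => y; rewrite expr0 mul1r.
have -> : E1 (ramp c N) - E2 (ramp c N) =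
   (E2 (fun y => p.[y]) - E2 (ramp c N)) -
     (E1 (fun y => p.[y]) - E1 (ramp c N)).
  by rewrite pE; ring.
apply: le_trans (ler_normB _ _) _; apply: le_trans (lerD c2 c1) _.
rewrite -mulrDr mulrAC ler_pdivrMr// ler_wpM2l ?(ltW e0)//.
by rewrite /K addrC lerDl.
Qed.

(** Equal moments give equal integrals of polynomials, hence of ramps by uniform
    approximation, hence of the indicator of [c, +oo) by dominated
    convergence. *)
Lemma moments_tail (c : R) :
  \int[m1]_(x in A1) ((c <= D1 x)%R%:R * w1 x) =
  \int[m2]_(x in A2) ((c <= D2 x)%R%:R * w2 x).
Proof.
have c1 := @cvg_weighted_ramp _ _ _ m1 A1 D1 w1 mA1 mD1 w1_ge0 iw1 c.
have c2 := @cvg_weighted_ramp _ _ _ m2 A2 D2 w2 mA2 mD2 w2_ge0 iw2 c.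
have E12 : (fun N => E1 (ramp c N)) = (fun N => E2 (ramp c N)).
  by apply/funext => N; exact: ramp_moments.
have {}c1 : E2 (ramp c N) @[N --> \oo] --> E1 (fun y => (c <= y)%R%:R).
  by rewrite -E12.
exact: (cvg_unique _ c1 c2).
Qed.

End MomentUniqueness.

(** * Beta densities *)

Section BetaDensity.
Context (R : realType).
Local Notation mu := (@lebesgue_measure R).

Lemma Rintegral_sum d (T : measurableType d) (m : {measure set T -> \bar R})
    (D : set T) (n : nat) (F : nat -> T -> R) : measurable D ->
  (forall i, m.-integrable D (EFin \o F i)) ->
  \int[m]_(x in D) (\sum_(i < n) F i x) = \sum_(i < n) \int[m]_(x in D) F i x.
Proof.
move=> mD iF.
have iS k : m.-integrable D (EFin \o (fun x => \sum_(i < k) F i x)).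
  rewrite (_ : _ \o _ = fun x => (\sum_(i < k) (F i x)%:E)%E).
    by apply: integrable_sum => // i _; exact: iF.
  by apply/funext => x; rewrite /= sumEFin.
elim: n => [|n IHn].
  rewrite big_ord0; under eq_Rintegral do rewrite big_ord0.
  by rewrite Rintegral_cst// mul0r.
rewrite big_ord_recr /= -IHn -RintegralD//.
by apply: eq_Rintegral => x _; rewrite big_ord_recr.
Qed.

Lemma continuous_integrable01 (f : R -> R) : continuous f ->
  mu.-integrable `[0, 1] (EFin \o f).
Proof.
move=> cf; apply: continuous_compact_integrable; first exact: segment_compact.
exact: continuous_subspaceT.
Qed.

Lemma Rintegral_oo01 (f : R -> R) : continuous f ->
  \int[mu]_(x in `]0, 1[) f x = \int[mu]_(x in `[0, 1]) f x.
Proof.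
move=> cf; congr fine; rewrite -(@integral_itv_bndoo _ _ _ _ true false)//.
apply/measurable_EFinP; apply: measurable_funTS.
exact: continuous_measurable_fun.
Qed.

Lemma g_betaE k (x : R) :
  g_beta k x = (2 * k + 1)`!%:R / k`!%:R ^+ 2 * XMonemX k k x.
Proof. by rewrite /g_beta mulrA. Qed.

Lemma continuous_g_beta k : continuous (@g_beta R k).
Proof.
rewrite (_ : @g_beta R k =
  fun x => (2 * k + 1)`!%:R / k`!%:R ^+ 2 * XMonemX k k x).
  by move=> x; apply: cvgMl_tmp; exact: continuous_XMonemX.
by apply/funext => x; exact: g_betaE.
Qed.

Lemma measurable_g_beta k : measurable_fun setT (@g_beta R k).
Proof. exact: continuous_measurable_fun (@continuous_g_beta k). Qed.

Lemma g_beta_ge0 k (x : R) : 0 < x < 1 -> 0 <= g_beta k x.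
Proof.
move=> /andP[x0 x1];
  rewrite !mulr_ge0 ?exprn_ge0 ?subr_ge0 ?invr_ge0 ?(ltW x0) ?(ltW x1)//.
Qed.

Lemma g_beta_constE k :
  (2 * k + 1)`!%:R / k`!%:R ^+ 2 = (beta_fun k.+1 k.+1)^-1 :> R.
Proof.
rewrite beta_fun_fact natrM invf_div; congr (_`!%:R / _).
by rewrite mul2n addnn addn1.
Qed.

Lemma g_beta_pdf k (x : R) : 0 < x < 1 -> g_beta k x = beta_pdf k.+1 k.+1 x.
Proof.
move=> /andP[x0 x1]; rewrite g_betaE g_beta_constE /beta_pdf /= mulrC patchE.
by rewrite mem_set//= in_itv/= !ltW.
Qed.

Lemma g_beta_density k : is_density `]0, 1[ (@g_beta R k).
Proof.
split.
- exact: measurable_funTS (@measurable_g_beta k).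
- by move=> x /=; rewrite in_itv/=; exact: g_beta_ge0.
rewrite -(@integral_itv_bndoo _ _ _ _ true false); last first.
  by apply/measurable_EFinP/measurable_funTS; exact: measurable_g_beta.
under eq_integral do rewrite g_betaE g_beta_constE EFinM.
rewrite ge0_integralZl//; last 3 first.
- by apply/measurable_EFinP; exact: measurable_XMonemX.
- by move=> x /= x01; rewrite lee_fin XMonemX_ge0.
- by rewrite lee_fin invr_ge0 beta_fun_ge0.
have -> : (\int[mu]_(x in `[0%R, 1%R]) (XMonemX k k x)%:E =
  (beta_fun k.+1 k.+1)%:E)%E.
  rewrite EFin_beta_fun /= -[in RHS](setTI [set: R]) integral_XMonemX_restrict.
  by rewrite !setTI.
by rewrite -EFinM mulVf// gt_eqF// beta_fun_gt0.
Qed.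

Let continuous_expRM (s : R) : continuous (fun x : R => expR (s * x)).
Proof.
move=> x; have c : s * y @[y --> x] --> s * x by apply: cvgMl_tmp;
  exact: cvg_id.
exact: (cvg_comp _ _ c (@continuous_expR R _)).
Qed.

Lemma laplace_g_beta k (s : R) : laplace `]0, 1[ (@g_beta R k) s = g_hat k s.
Proof.
have cpow i : continuous (fun x : R => expR (- s * x) * x ^+ i).
  by move=> x; apply: cvgM; [exact: continuous_expRM|exact: exprn_continuous].
have cg : continuous (fun x : R => expR (- s * x) * g_beta k x).
  by move=> x; apply: cvgM; [exact: continuous_expRM|exact: continuous_g_beta].
rewrite /laplace Rintegral_oo01// /g_hat.
set c := _ / _.
transitivity (\int[mu]_(x in `[0, 1]) (c * \sum_(i < k.+1)
   ((-1) ^+ i * 'C(k, i)%:R) * (expR (- s * x) * x ^+ (k + i)))).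
  apply: eq_Rintegral => x _; rewrite /g_beta -/c.
  rewrite exprBn mulr_sumr !mulr_sumr; apply: eq_bigr => i _.
  by rewrite expr1n exprD -mulr_natr; ring.
have iF i : mu.-integrable `[0, 1] (EFin \o (fun x =>
    ((-1) ^+ i * 'C(k, i)%:R) * (expR (- s * x) * x ^+ (k + i)))).
  by apply: continuous_integrable01 => x; apply: cvgMl_tmp; exact: cpow.
rewrite RintegralZl//; last first.
  rewrite (_ : _ \o _ = fun x => (\sum_(i < k.+1)
    (((-1) ^+ i * 'C(k, i)%:R) * (expR (- s * x) * x ^+ (k + i)))%:E)%E).
    by apply: integrable_sum => // i _; exact: iF.
  by apply/funext => x; rewrite /= sumEFin.
rewrite (Rintegral_sum _ _ iF)//; congr (_ * _); apply: eq_bigr => i _.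
rewrite RintegralZl//.
exact: continuous_integrable01.
Qed.

Lemma g_beta_sym k (x : R) : g_beta k (1 - x) = g_beta k x.
Proof. by rewrite !g_betaE XMonemXC. Qed.

(** The density is symmetric about 1/2, so its transform at -a is e^a times the
    one at a. *)
Lemma cosh_transform_g_beta k (a : R) :
  \int[mu]_(x in `]0, 1[) (cosh (a * (x - 1 / 2)) * g_beta k x) =
  expR (a / 2) * g_hat k a.
Proof.
have ce s : continuous (fun x : R => expR (s * x) * g_beta k x).
  by move=> x; apply: cvgM; [exact: continuous_expRM|exact: continuous_g_beta].
have ie s := continuous_integrable01 (ce s).
pose L s := \int[mu]_(x in `[0, 1]) (expR (s * x) * g_beta k x).
have Lneg : L (- a) = g_hat k a.
  by rewrite -laplace_g_beta /laplace Rintegral_oo01.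
have Lpos : L a = expR a * g_hat k a.
  rewrite -Lneg /L Rintegration_by_substitution_onem ?lexx ?ler01//; last first.
    exact: continuous_subspaceT.
  rewrite onem1 -RintegralZl//.
  apply: eq_Rintegral => x _; rewrite /onem g_beta_sym mulrA -expRD.
  by congr (expR _ * _); ring.
have -> : (fun x => cosh (a * (x - 1 / 2)) * g_beta k x) = (fun x =>
    expR (- (a / 2)) / 2 * (expR (a * x) * g_beta k x) +
    expR (a / 2) / 2 * (expR (- a * x) * g_beta k x)).
  apply/funext => x; rewrite /cosh (_ : a * (x - 1 / 2) = - (a / 2) + a * x);
    last by field.
  rewrite (_ : - (- (a / 2) + a * x) = a / 2 + - a * x); last by ring.
  by rewrite !expRD; field.
rewrite Rintegral_oo01; last first.
  by move=> x; apply: cvgD; apply: cvgMl_tmp; exact: ce.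
rewrite RintegralD//; last 2 first.
- exact: (integrableZl _ _ (ie a)).
- exact: (integrableZl _ _ (ie (- a))).
rewrite !RintegralZl//.
rewrite -/(L a) -/(L (- a)) Lpos Lneg.
have -> : expR a = expR (a / 2) * expR (a / 2) by rewrite -expRD;
  congr expR; field.
rewrite expRN; field; rewrite gt_eqF ?expR_gt0//.
Qed.

End BetaDensity.

(** * Moments of the discounted exit time *)

Section ExitMoments.
Context d (T : measurableType d) (R : realType) (P : probability T R).
Variables (eta : {RV P >-> R}) (B : nat -> R -> {RV P >-> R})
  (ev : nat -> {RV P >-> R}) (X : R -> T -> R) (g : R -> R).
Hypothesis HX : brownian_resetting 1 (1 / 2) eta B ev X.
Hypothesis g_density : is_density `]0, 1[ g.
Hypothesis eta_g : has_density eta `]0, 1[ g.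

Lemma alpha_sqr (l : nat) : alpha (l%:R : R) ^+ 2 / 2 = l.+1%:R.
Proof.
rewrite /alpha sqr_sqrtr; last by rewrite mulr_ge0// addr_ge0.
by rewrite natr1; field.
Qed.

Lemma alpha_ge0 (l : R) : 0 <= alpha l.
Proof. exact: sqrtr_ge0. Qed.

(** The path starts at the centre, where the cosine equals 1. *)
Lemma exit_moment_restart l n :
  cosh (alpha l%:R / 2) * exit_moment eta B l.+1 n.+1 = 1.
Proof.
have half01 (w : T) : 0 < start eta n.+1 w < 1 by rewrite /=; lra.
rewrite /exit_moment /exit_factor
  (hit_exits_transform _ (reset_brownian HX n.+1)
  _ half01 _ (alpha_ge0 _) (alpha_sqr l))//; last 2 first.
- exact: measurable_start.
- by move=> A E mA sE; exact: (start_path_indep HX mA sE).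
under eq_Rintegral do rewrite /= subrr mulr0 /cosh oppr0 expR0.
rewrite Rintegral_cst// (_ : fine (P setT) = 1)//;
  last by rewrite probability_setT.
by field.
Qed.

(** The starting position lies in (0, 1) almost surely.  [clip] moves it inside
    for all outcomes, without changing it when it is already there. *)
Let clip (x : R) : R := 1 / 2 + (x - 1 / 2) * \1_(`]0, 1[) x.

Let clipE x : 0 < x < 1 -> clip x = x.
Proof.
by move=> x01; rewrite /clip indicE mem_set ?mulr1 /= ?in_itv//; ring.
Qed.

Let clip01 x : 0 < clip x < 1.
Proof.
case: (boolP (x \in `]0, 1[%classic)) => [|/negPf xI].
  by rewrite inE/= in_itv/= => x01; rewrite clipE.
by rewrite /clip indicE xI mulr0; lra.
Qed.

Let measurable_clip : measurable_fun setT clip.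
Proof.
apply: measurable_funD => //; apply: measurable_funM;
  last exact: measurable_indic.
exact: measurable_funB.
Qed.

Let eta_outside : P (eta @^-1` (~` `]0, 1[)) = 0%E.
Proof. by rewrite eta_g ?setICl ?integral_set0//; exact: measurableC. Qed.

(** The exit transform needs a starting point that is inside for every outcome,
    hence the change of eta on a null event; then E[cosh(a (eta - 1/2))] is
    computed with the density. *)
Lemma exit_moment_start l : cosh (alpha l%:R / 2) * exit_moment eta B l.+1 0 =
  \int[lebesgue_measure]_(x in `]0, 1[) (cosh (alpha l%:R * (x - 1 / 2)) * g x).
Proof.
set a := alpha _.
pose S0 w := clip (eta w).
have mS0 : measurable_fun setT S0 by exact: measurableT_comp.
have S0_in w : 0 < S0 w < 1 by exact: clip01.
have S0_W A E : measurable A ->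
  sigma_process `[0, +oo[ (fun t => B 0%N t : T -> R) E ->
    P (S0 @^-1` A `&` E) = (P (S0 @^-1` A) * P E)%E.
  move=> mA sE; apply: (start_path_indep HX (n := 0) (A := clip @^-1` A)) => //.
  by rewrite -[X in measurable X]setTI; exact: measurable_clip.
have mfactor :
  measurable_fun setT (fun w => hit (exits (started_path S0 (B 0%N) w))).
  apply: measurable_hit_exits => [t t0|w].
    by apply: measurable_funD.
  exact: (@started_path_continuous _ _ _ _ S0 _ (reset_brownian HX 0) w).
have -> : exit_moment eta B l.+1 0 =
    \int[P]_w (hit (exits (started_path S0 (B 0%N) w)) ^+ l.+1).
  congr fine; apply: ae_eq_integral => //.
  - apply/measurable_EFinP; apply: measurable_funX.
    exact: measurable_exit_factor HX 0.
  - by apply/measurable_EFinP; apply: measurable_funX.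
  - exists (eta @^-1` (~` `]0, 1[)); split => //.
      by rewrite -[X in measurable X]setTI; apply: measurable_funP => //;
        exact: measurableC.
    move=> w /= neq etaI; have et : 0 < eta w < 1 by move: etaI; rewrite in_itv.
    apply: neq => _; congr (hit (exits _) ^+ _)%:E.
    by apply/funext => t; rewrite /started_path /S0 clipE.
rewrite
  (hit_exits_transform mS0 (reset_brownian HX 0) S0_W S0_in _ (alpha_ge0 _)
  (alpha_sqr l))//.
have [mg g0 _] := g_density.
pose gI := g \_ `]0, 1[.
have gI0 x : 0 <= gI x.
  by rewrite /gI patchE; case: ifPn => [/set_mem/g0|].
have mgI : measurable_fun setT gI.
  exact: (proj1 (measurable_restrictT g (measurable_itv `]0, 1[)) mg).
have lawI A : measurable A -> P (eta @^-1` A) =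
    (\int[lebesgue_measure]_(x in A) (gI x)%:E)%E.
  move=> mA; rewrite eta_g// integral_mkcondr; apply: eq_integral => x _.
  by rewrite /gI !patchE; case: ifPn.
pose h x : \bar R := (cosh (a * (clip x - 1 / 2)))%:E.
have h0 x : (0 <= h x)%E by rewrite lee_fin cosh_ge0.
have mh : measurable_fun setT h.
  apply/measurable_EFinP; apply: (measurableT_comp (@measurable_cosh R)).
  by apply: measurable_funM => //; exact: measurable_funB.
congr fine; rewrite -[LHS]/(\int[P]_w h (eta w))%E.
rewrite (ge0_integral_rv_density _ mgI gI0 lawI mh h0)//.
rewrite [RHS]integral_mkcond; apply: eq_integral => x _.
rewrite /gI /h !patchE; case: ifPn => [/set_mem xI|_]; last by rewrite mule0.
by rewrite -EFinM clipE//; move: xI; rewrite /= in_itv.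
Qed.

Let path n (w : T) : R -> R := started_path (start eta n) (B n) w.

Let X_path w n t : ev n w <= t < ev n.+1 w -> X t w = path n w (t - ev n w).
Proof.
have ev0 := pp_start (reset_poisson HX) w.
case: n => [|n] nt; last exact: (reset_restart HX).
by rewrite (reset_initial HX) /path ?ev0 ?subr0// -{1}ev0.
Qed.

Let path_start w n : (0 < n)%N -> 0 < path n w 0 < 1.
Proof.
case: n => // n _; rewrite /path /started_path /=.
by rewrite (bm_start (reset_brownian HX n.+1)); lra.
Qed.

Let cycles (l N : nat) (w : T) : R := \sum_(n < N)
  cycle_term (fun k => expR (- clock ev k w)) (fun k => exit_factor eta B k w) l
    n.

Let cvg_cycles_exit l w : (0 < l)%N ->
  cycles l N w @[N --> \oo] --> hit (exits (X^~ w)) ^+ l.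
Proof.
move=> l0; apply: (cvg_cycles (X := X^~ w) (Y := fun n => path n w)
  (ev := fun n => ev n w)) => //.
- exact: pp_start (reset_poisson HX) w.
- by move=> n; exact: pp_increasing (reset_poisson HX) n w.
- exact: pp_locally_finite (reset_poisson HX) w.
- exact: X_path.
- exact: path_start.
Qed.

Let cycles01 l N w : 0 <= cycles l N w <= 1.
Proof.
apply: (cycles_bound (X := X^~ w) (Y := fun n => path n w)
  (ev := fun n => ev n w)) => //.
- exact: pp_start (reset_poisson HX) w.
- by move=> n; exact: pp_increasing (reset_poisson HX) n w.
- exact: pp_locally_finite (reset_poisson HX) w.
- exact: X_path.
- exact: path_start.
Qed.

Let measurable_term l n : measurable_fun setT (fun w =>
  cycle_term (fun k => expR (- clock ev k w)) (fun k => exit_factor eta B k w) l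
    n).
Proof.
have mV k : measurable_fun setT (exit_factor eta B k) by
  exact: measurable_exit_factor HX k.
have mU k : measurable_fun setT (fun w => expR (- clock ev k w)).
  by apply: measurableT_comp => //; apply: measurableT_comp.
have mb (b : T -> bool) : measurable_fun setT b ->
  measurable_fun setT (fun w => (b w)%:R : R).
  exact: (measurableT_comp (f := fun b : bool => b%:R : R)).
apply: measurable_funM.
  apply: measurable_prod => k _; apply: measurable_funM;
    first exact: measurable_funX.
  by apply: mb; exact: measurable_fun_ler.
apply: measurable_funM; first exact: measurable_funX.
by apply: mb; exact: measurable_fun_ltr.
Qed.

Let measurable_cycles l N : measurable_fun setT (cycles l N).
Proof. by apply: measurable_sum. Qed.

Lemma measurable_exit : measurable_fun setT (fun w => hit (exits (X^~ w))).
Proof.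
apply: (measurable_fun_cvg (h := cycles 1)) => [N|w _];
  first exact: measurable_cycles.
have := @cvg_cycles_exit 1 w isT; by rewrite expr1.
Qed.

Let term01 l n w : 0 <=
  cycle_term (fun k => expR (- clock ev k w)) (fun k => exit_factor eta B k w) l
    n <= 1.
Proof.
have := cycles01 l n.+1 w; have := cycles01 l n w.
rewrite /cycles big_ord_recr /=; move: (\sum_(_ < _) _) => s.
move=> /andP[s0 s1] /andP[t0 t1]; apply/andP; split; last by move: s0 t1; lra.
apply: mulr_ge0; last by rewrite mulr_ge0 ?exprn_ge0 ?hit_ge0.
by apply: prodr_ge0 => k _; rewrite mulr_ge0 ?exprn_ge0 ?expR_ge0.
Qed.

Let integrable_term l n : P.-integrable setT (EFin \o (fun w =>
  cycle_term (fun k => expR (- clock ev k w)) (fun k => exit_factor eta B k w) l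
    n)).
Proof.
apply: (@bounded_integrable _ _ _ P _ _ 1) => // w.
by have /andP[? ?] := term01 l n w; rewrite ger0_norm.
Qed.

Let m0 l := exit_moment eta B l.+1 0.
Let m l := exit_moment eta B l.+1 1.

Let restartE l n : exit_moment eta B l.+1 n.+1 = m l.
Proof.
apply: (mulfI (lt0r_neq0 (cosh_gt0 (alpha (l%:R : R) / 2)))).
by rewrite /m !exit_moment_restart.
Qed.

Let m01 l : 0 < m l <= 1.
Proof.
have H := exit_moment_restart l 0; have c0 := cosh_gt0 (alpha (l%:R : R) / 2).
have m_gt0 : 0 < m l by rewrite -(pmulr_rgt0 _ c0) H.
rewrite m_gt0 -(ler_pM2l c0) H mulr1.
have -> : (1 : R) = cosh 0 by rewrite /cosh oppr0 expR0; field.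
by rewrite le_cosh// normr0.
Qed.

Let y l : R := (1 - m l) / l.+1%:R.

Let y01 l : 0 <= y l < 1.
Proof.
have /andP[m_gt0 m_le1] := m01 l.
rewrite /y divr_ge0 ?subr_ge0//= ltr_pdivrMr// mul1r.
by rewrite (@lt_le_trans _ _ 1) ?ler1n// ltrBlDr ltrDl.
Qed.

Let cycle_expectation l n : \int[P]_w cycle_term
    (fun k => expR (- clock ev k w)) (fun k => exit_factor eta B k w) l n =
  if n is j.+1 then (1 - m0 l) / l.+1%:R * y l ^+ j * m l else m0 l.
Proof.
rewrite (expectation_cycle_term HX); case: n => [|n];
  first by rewrite big_ord0 mul1r.
rewrite big_ord_recl restartE; congr (_ * _ * _).
rewrite (eq_bigr (fun=> y l)); first by rewrite prodr_const card_ord.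
by move=> k _; rewrite lift0 restartE.
Qed.

(** The expectations of the cycle terms form a geometric sequence from cycle 1
    on. *)
Lemma exit_moments l : (0 < l)%N ->
  \int[P]_w (hit (exits (X^~ w)) ^+ l) =
  (l%:R * m0 l + m l) / (l%:R + m l).
Proof.
move=> l0; have /andP[m_gt0 m_le1] := m01 l; have /andP[y0 y1] := y01 l.
have lR : 0 < l%:R :> R by rewrite ltr0n.
(* With y = (1 - m) / (l + 1), the ratio of the geometric sequence, l + m is
   (l + 1) (1 - y). *)
have sumE N : \int[P]_w cycles l N.+1 w = (l%:R * m0 l + m l) / (l%:R + m l) -
    (1 - m0 l) / (l%:R + m l) * m l * y l ^+ N.
  rewrite (Rintegral_sum N.+1 measurableT (integrable_term l)).
  elim: N => [|N IHN].
    rewrite big_ord_recr big_ord0 /= add0r cycle_expectation expr0.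
    by field; rewrite gt_eqF// addr_gt0.
  rewrite big_ord_recr /= IHN cycle_expectation exprS.
  have -> : y l = (1 - m l) / (l%:R + 1) by rewrite /y natr1.
  rewrite -natr1; field.
  by rewrite !gt_eqF// ?addr_gt0.
have cvg_exit : \int[P]_w cycles l N.+1 w @[N --> \oo] -->
    \int[P]_w (hit (exits (X^~ w)) ^+ l).
  rewrite (cvg_shiftS (fun N => \int[P]_w cycles l N w)) /=.
  apply: (@cvg_Rintegral_bounded _ _ _ P _ _ 1) => //.
  - by apply: measurable_funX; exact: measurable_exit.
  - by move=> N w; have /andP[? ?] := cycles01 l N w; rewrite ger0_norm.
  - by move=> w; exact: (@cvg_cycles_exit l w l0).
have limit : (l%:R * m0 l + m l) / (l%:R + m l) -
    (1 - m0 l) / (l%:R + m l) * m l * y l ^+ N @[N --> \oo] -->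
    (l%:R * m0 l + m l) / (l%:R + m l).
  rewrite -[X in _ --> X]subr0; apply: cvgB; first exact: cvg_cst.
  rewrite -[X in _ --> X](mulr0 ((1 - m0 l) / (l%:R + m l) * m l)).
  by apply: cvgMl_tmp; apply: cvg_expr; rewrite ger0_norm.
move: cvg_exit; rewrite (eq_cvg _ _ sumE) => cvg_exit.
exact: (cvg_unique _ cvg_exit limit).
Qed.

End ExitMoments.

(** * Mixtures of Beta densities and the inverse problem *)

Section Mixture.
Context (R : realType).
Local Notation mu := (@lebesgue_measure R).

Definition beta_mixture (N : nat) (p : nat -> R) (x : R) : R :=
  \sum_(1 <= k < N.+1) p k * g_beta k x.

Lemma beta_mixtureE N (p : nat -> R) x :
  beta_mixture N p x = \sum_(i < N) p i.+1 * g_beta i.+1 x.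
Proof. by rewrite /beta_mixture big_add1 big_mkord. Qed.

Lemma density_integrable (D : set R) (g : R -> R) :
  is_density D g -> mu.-integrable D (EFin \o g).
Proof.
move=> [mg g0 g1]; apply/integrableP; split; first exact/measurable_EFinP.
suff -> : (\int[mu]_(x in D) `|(EFin \o g) x| = 1)%E by rewrite ltry.
rewrite -g1; apply: eq_integral => x /set_mem /g0 gx.
by rewrite /= ger0_norm.
Qed.

Let beta_integrable k : mu.-integrable `]0, 1[ (EFin \o @g_beta R k).
Proof. exact: density_integrable (@g_beta_density R k). Qed.

Let beta_integral k : \int[mu]_(x in `]0, 1[) g_beta k x = 1.
Proof. by have [_ _ g1] := @g_beta_density R k; rewrite /Rintegral g1. Qed.

Lemma beta_mixture_density N (p : nat -> R) :
  (forall k, (1 <= k <= N)%N -> 0 <= p k) -> \sum_(1 <= k < N.+1) p k = 1 ->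
  is_density `]0, 1[ (beta_mixture N p).
Proof.
move=> p0 p1.
have mixE : beta_mixture N p = fun x => \sum_(i < N) p i.+1 * g_beta i.+1 x.
  by apply/funext => x; exact: beta_mixtureE.
have mg : measurable_fun setT (beta_mixture N p).
  rewrite mixE; apply: measurable_sum => i; apply: measurable_funM => //.
  exact: measurable_g_beta.
have iF i : mu.-integrable `]0, 1[ (EFin \o (fun x => p i.+1 * g_beta i.+1 x)).
  exact: (integrableZl _ _ (beta_integrable i.+1)).
split; first exact: measurable_funTS.
- move=> x; rewrite /= in_itv/= => x01; rewrite mixE; apply: sumr_ge0 => i _.
  by rewrite mulr_ge0 ?g_beta_ge0// p0/=.
have imix : mu.-integrable `]0, 1[ (EFin \o beta_mixture N p).
  rewrite (_ : _ \o _ = fun x => (\sum_(i < N) (p i.+1 * g_beta i.+1 x)%:E)%E).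
    by apply: integrable_sum => // i _; exact: iF.
  by apply/funext => x; rewrite /= sumEFin mixE.
rewrite -(fineK (integrable_fin_num _ imix))//; congr EFin.
rewrite -[LHS]/(\int[mu]_(x in `]0, 1[) beta_mixture N p x) mixE.
rewrite (Rintegral_sum _ _ iF)// -[RHS]p1 big_add1 big_mkord.
by apply: eq_bigr => i _; rewrite RintegralZl// beta_integral mulr1.
Qed.

Lemma beta_mixture_cosh N (p : nat -> R) (a : R) :
  \int[mu]_(x in `]0, 1[) (cosh (a * (x - 1 / 2)) * beta_mixture N p x) =
  expR (a / 2) * \sum_(1 <= k < N.+1) p k * g_hat k a.
Proof.
have cc k : continuous (fun x : R => cosh (a * (x - 1 / 2)) * @g_beta R k x).
  have inner (x : R) : a * (u - 1 / 2) @[u --> x] --> a * (x - 1 / 2).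
    by apply: cvgMl_tmp; apply: cvgB; [exact: cvg_id|exact: cvg_cst].
  move=> x; apply: cvgM; last exact: continuous_g_beta.
  apply: cvgMr_tmp; apply: cvgD.
    exact: (cvg_comp _ _ (inner x) (@continuous_expR R _)).
  exact: (cvg_comp _ _ (cvgN (inner x)) (@continuous_expR R _)).
have ic k : mu.-integrable `]0, 1[ (EFin \o
    (fun x => cosh (a * (x - 1 / 2)) * @g_beta R k x)).
  apply: integrableS (continuous_integrable01 (cc k)) => //.
  by apply: subset_itvW; rewrite bnd_simp.
have iF i : mu.-integrable `]0, 1[ (EFin \o
    (fun x => p i.+1 * (cosh (a * (x - 1 / 2)) * @g_beta R i.+1 x))).
  exact: (integrableZl _ _ (ic i.+1)).
transitivity (\int[mu]_(x in `]0, 1[)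
    (\sum_(i < N) p i.+1 * (cosh (a * (x - 1 / 2)) * g_beta i.+1 x))).
  apply: eq_Rintegral => x _; rewrite beta_mixtureE mulr_sumr.
  by apply: eq_bigr => i _; rewrite mulrCA.
rewrite (Rintegral_sum _ _ iF)// big_add1 big_mkord mulr_sumr.
apply: eq_bigr => i _; rewrite RintegralZl// cosh_transform_g_beta.
by rewrite mulrCA.
Qed.

(** With u = e^(a/2), numerator and denominator have the common factor
    u - 1/u. *)
Lemma f_hatE k (l : R) : 0 < l ->
  f_hat k l = (1 + l * (expR (alpha l / 2) * g_hat k (alpha l))) /
    (l * cosh (alpha l / 2) + 1).
Proof.
move=> l0; have a0 : 0 < alpha l by rewrite sqrtr_gt0 mulr_gt0// addr_gt0.
rewrite /f_hat /sinh /cosh; set a := alpha l; set u := expR (a / 2).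
have u1 : 1 < u by rewrite -expR0 ltr_expR divr_gt0.
have u0 : 0 < u := lt_trans ltr01 u1.
have -> : expR a = u * u by rewrite -expRD; congr expR; field.
have -> : expR (- a) = u^-1 * u^-1 by rewrite -!expRN -expRD; congr expR; field.
have -> : expR (- (a / 2)) = u^-1 by rewrite expRN.
have s0 : u - u^-1 != 0.
  by rewrite subr_eq0 gt_eqF// (lt_trans _ u1)// invf_lt1.
have c0 : l * ((u + u^-1) / 2) + 1 != 0.
  by rewrite gt_eqF// addr_gt0// mulr_gt0// divr_gt0// addr_gt0// invr_gt0.
have -> : 2 * ((u - u^-1) / 2) + l * (u * u - 1) * g_hat k a =
    (u - u^-1) * (1 + l * (u * g_hat k a)) by field; rewrite gt_eqF.
have -> : l * ((u * u - u^-1 * u^-1) / 2) + 2 * ((u - u^-1) / 2) =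
    (u - u^-1) * (l * ((u + u^-1) / 2) + 1) by field; rewrite gt_eqF.
by rewrite -mulf_div divff// mul1r.
Qed.

Lemma mixture_f_hat N (p : nat -> R) (l : R) : 0 < l ->
  \sum_(1 <= k < N.+1) p k = 1 ->
  \sum_(1 <= k < N.+1) p k * f_hat k l =
  (1 + l *
    (expR (alpha l / 2) * \sum_(1 <= k < N.+1) p k * g_hat k (alpha l))) /
    (l * cosh (alpha l / 2) + 1).
Proof.
move=> l0 p1; under eq_bigr do rewrite f_hatE// mulrA mulrDr mulr1.
rewrite -mulr_suml big_split /= p1; congr ((1 + _) / _).
by rewrite !mulr_sumr; apply: eq_bigr => k _; ring.
Qed.

End Mixture.

Theorem proposition3p3 (R : realType) (N : nat) (p : nat -> R) (f : R -> R)
  (N_ge1 : (1 <= N)%N)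
  (p_ge0 : forall k : nat, (1 <= k <= N)%N -> 0 <= p k)
  (p_sum : \sum_(1 <= k < N.+1) p k = 1)
  (f_density : is_density `]0, +oo[ f)
  (f_laplace : forall l : R, 0 < l ->
     laplace `]0, +oo[ f l = \sum_(1 <= k < N.+1) p k * f_hat k l) :
  exists g : R -> R,
    [/\ inverse_fet_solution 1 1 (1 / 2) f g,
        forall x : R, 0 < x < 1 ->
          g x = \sum_(1 <= k < N.+1) p k * g_beta k x &
        forall k : nat, (1 <= k <= N)%N ->
          [/\ is_density `]0, 1[ (@g_beta R k),
              forall s : R, 0 < s -> laplace `]0, 1[ (@g_beta R k) s = g_hat k s &
              forall x : R, 0 < x < 1 -> g_beta k x = beta_pdf k.+1 k.+1 x]].
Proof.
exists (beta_mixture N p); split => [|//|k _]; last first.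
  split => [|s _|x]; first exact: g_beta_density.
    exact: laplace_g_beta.
  exact: g_beta_pdf.
have g_dens := beta_mixture_density p_ge0 p_sum.
split => // d T P eta B ev X HX eta_g t t0.
have [mf f0 f1] := f_density.
have i_f := density_integrable f_density.
pose D w := hit (exits (X^~ w)).
have mD : measurable_fun setT D by exact: measurable_exit HX.
have i1 : P.-integrable setT (EFin \o cst (1 : R)).
  by apply: (@bounded_integrable _ _ _ P _ _ 1) => // w; rewrite normr1.
have expN_le1 (x : R) : `]0, +oo[%classic x -> 0 <= expR (- x) <= 1.
  rewrite /= in_itv/= andbT => x0.
  by rewrite expR_ge0 -[leRHS]expR0 ler_expR oppr_le0 ltW.
have moments n : \int[P]_w (D w ^+ n * cst 1 w) =
    \int[lebesgue_measure]_(x in `]0, +oo[) (expR (- x) ^+ n * f x).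
  case: n => [|n].
    under eq_Rintegral do rewrite expr0 mulr1.
    under [RHS]eq_Rintegral do rewrite expr0 mul1r.
    rewrite Rintegral_cst// mul1r /Rintegral f1 (_ : fine (P setT) = 1)//.
    by rewrite probability_setT.
  have n0 : 0 < n.+1%:R :> R by [].
  transitivity (laplace `]0, +oo[ f n.+1%:R); last first.
    by apply: eq_Rintegral => x _; rewrite -expRM_natl mulNr mulrN.
  rewrite f_laplace// mixture_f_hat//.
  under eq_Rintegral do rewrite mulr1.
  rewrite (exit_moments HX)//.
  have m1 := exit_moment_restart HX n.+1 0.
  have := exit_moment_start HX g_dens eta_g n.+1.
  rewrite beta_mixture_cosh => <-; move: m1.
  move: (exit_moment _ _ _ 1) (exit_moment _ _ _ 0)
    (cosh_gt0 (alpha (n.+1%:R : R) / 2)).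
  move: (cosh _) => c m m0 c0 cm.
  have mE : m = c^-1 by apply: (mulfI (lt0r_neq0 c0));
    rewrite cm divff// gt_eqF.
  rewrite mE; field.
  by rewrite !gt_eqF// ?addr_gt0 ?mulr_gt0.
have mexpN : measurable_fun (`]0, +oo[%classic : set R)
  (fun x : R => expR (- x)).
  by apply: measurable_funTS; apply: measurableT_comp.
have D01 w : setT w -> 0 <= D w <= 1 by rewrite hit_ge0 hit_le1.
have mpos : measurable (`]0, +oo[%classic : set (measurableTypeR R)).
  exact: measurable_itv.
(* The law of e^(-tau) and the image of f(x) dx by e^(-x) have the same
   moments. *)
have tail := moments_tail measurableT mpos mD mexpN D01 expN_le1
  (fun _ _ => ler01) f0 i1 i_f moments (expR (- t)).
have exitE : [set w | (first_exit_time 1 X w <= t%:E)%E] =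
  [set w | expR (- t) <= D w].
  by apply/seteqP; split => w;
    [move/first_exit_time_le|move=> ?; apply/first_exit_time_le].
have mexit : measurable [set w | expR (- t) <= D w].
  have mb : measurable_fun setT (fun w => expR (- t) <= D w) by
    exact: measurable_fun_ler.
  by have := mb measurableT [set true] I; rewrite setTI.
rewrite exitE -(setIT [set w | _]) -integral_indic//.
transitivity (\int[P]_w ((expR (- t) <= D w)%R%:R * cst 1 w))%:E.
  rewrite -(@ge0_Rintegral_fineK _ _ _ P _ 1).
  - apply: eq_integral => w _; rewrite indicE mulr1.
    case: (boolP (expR (- t) <= D w)) => Dw; first by rewrite mem_set.
    by rewrite memNset//; exact/negP.
  - apply: measurable_funM => //.
    by apply: (measurableT_comp (f := fun b : bool => b%:R : R)) => //;
      exact: measurable_fun_ler.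
  - by move=> w; rewrite mulr1; case: (expR (- t) <= D w); rewrite ?lexx ?ler01.
rewrite tail /cdf_pos Rintegral_mkcond [in RHS]Rintegral_mkcond; congr (_%:E).
apply: eq_Rintegral => x _; rewrite !patchE !mem_setE /= !in_itv/= andbT.
rewrite ler_expR lerN2; case: (0 < x) => //=.
by case: (x <= t); rewrite ?mul1r ?mul0r.
Qed.
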